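(* Let $G$ be a finite group, let $\mathbb{F}$ be a finite field, and let $\mathcal{A}$ be a finite $G$-graded associative $\mathbb{F}$-algebra. Then the variety $\mathrm{var}(\mathcal{A})$ of $G$-graded algebras generated by $\mathcal{A}$ is a Cross variety. In particular, the $T_G$-ideal $T_G(\mathcal{A})$ of $G$-graded polynomial identities of $\mathcal{A}$ satisfies the finite basis property, i.e. it is generated as a $T_G$-ideal by a finite set.
   Context: Algebras are associative $\mathbb{F}$-algebras, not necessarily unital. A $G$-graded algebra is an algebra $\mathcal{A}=\bigoplus_{g\in G}\mathcal{A}_g$ (subspaces) with $\mathcal{A}_g\mathcal{A}_h\subseteq\mathcal{A}_{gh}$; a subspace $W$ is graded if $W=\bigoplus_g (W\cap \mathcal{A}_g)$; homomorphisms of graded algebras are algebra homomorphisms mapping each degree-$g$ component into the degree-$g$ component. Let $X_G=\bigcup_{g\in G}X_g$ with $X_g=\{x_1^{(g)},x_2^{(g)},\dots\}$, and let $\mathbb{F}\langle X_G\rangle$ be the free associative algebra on $X_G$ (polynomials without constant term, as algebras need not be unital), $G$-graded by $\deg x_i^{(g)}=g$. A $T_G$-ideal is a $G$-graded two-sided ideal of $\mathbb{F}\langle X_G\rangle$ closed under all $G$-graded endomorphisms; the $T_G$-ideal generated by a set $S$ is the smallest one containing $S$. A polynomial $f(x_1^{(g_1)},\dots,x_k^{(g_k)})$ is a graded identity of $\mathcal{A}$ if $f(a_1,\dots,a_k)=0$ for all $a_i\in\mathcal{A}_{g_i}$; $T_G(\mathcal{A})$ is the set of all graded identities of $\mathcal{A}$.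 A variety of $G$-graded algebras is the class of all $G$-graded algebras satisfying a given set of graded identities; $\mathrm{var}(\mathcal{A})$ is the variety defined by $T_G(\mathcal{A})$. A variety is finitely based if it can be defined by finitely many graded identities. A variety is locally finite if every finitely generated $G$-graded algebra in it is finite. A graded section of $\mathcal{A}$ is a quotient $\mathcal{B}/\mathcal{C}$, with $\mathcal{B}$ a $G$-graded subalgebra of $\mathcal{A}$ and $\mathcal{C}$ a $G$-graded ideal of $\mathcal{B}$; it is proper unless $\mathcal{B}=\mathcal{A}$ and $\mathcal{C}=0$. A $G$-graded algebra is critical if it is finite and does not belong to the variety generated by its proper graded sections. A variety is a Cross variety if it is (i) locally finite, (ii) finitely based, and (iii) contains only finitely many critical $G$-graded algebras up to isomorphism. *)

(* Defs.v *)
From HB Require Import structures.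
From mathcomp Require Import all_boot all_order all_fingroup all_algebra.
From mathcomp Require Import generic_quotient ring_quotient finmap.
From mathcomp Require Import boolp classical_sets functions cardinality.
From mathcomp Require Import monalg.

Set Implicit Arguments.
Unset Strict Implicit.
Unset Printing Implicit Defensive.

Import GRing.Theory.

Local Open Scope quotient_scope.
Local Open Scope classical_set_scope.
Local Open Scope ring_scope.

Section DirectSum.
Variables (F : fieldType) (G : finGroupType) (V : lmodType F).

Definition subspace (W : set V) : Prop := GRing.submod_closed [in W].

Lemma subspaceP (W : set V) :
  subspace W <-> W 0 /\ forall c u v, W u -> W v -> W (c *: u + v).
Proof.
split=> -[W0 Wl].
  split; first exact: set_mem W0.
  by move=> c u v Wu Wv; apply/set_mem/(Wl c u v); apply/mem_set.
split; first exact: mem_set W0.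
by move=> c u v Wu Wv; apply/mem_set/Wl; apply/set_mem.
Qed.

Lemma subspace_sum (W : set V) (I : Type) (r : seq I) (u : I -> V) :
  subspace W -> (forall i, W (u i)) -> W (\sum_(i <- r) u i).
Proof.
move=> /subspaceP[W0 Wl] Wu; elim/big_rec: _ => // i x _ Wx.
by rewrite -[u i]scale1r; apply: Wl.
Qed.

Lemma subspaceB (W : set V) u v : subspace W -> W u -> W v -> W (u - v).
Proof.
by move=> /subspaceP[_ Wl] Wu Wv; rewrite addrC -scaleN1r; apply: Wl.
Qed.

(* W is the internal direct sum of the subspaces U g, g in G *)
Definition direct_sum (W : set V) (U : G -> set V) : Prop :=
  [/\ forall g, subspace (U g), forall g, U g `<=` W
    & forall w, W w ->
        exists! u : {ffun G -> V}, (forall g, U g (u g)) /\ w = \sum_g u g].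

Lemma direct_sumI (W : set V) (U : G -> set V) :
    (forall g, subspace (U g)) -> (forall g, U g `<=` W) ->
    (forall w, W w ->
       exists u : G -> V, (forall g, U g (u g)) /\ w = \sum_g u g) ->
    (forall u : G -> V, (forall g, U g (u g)) -> \sum_g u g = 0 ->
       forall g, u g = 0) ->
  direct_sum W U.
Proof.
move=> sU sUW ex un; split=> // w /ex[u [Uu ->]]; exists [ffun g => u g].
split; first by split=> [g|]; [rewrite ffunE | apply: eq_bigr => g _; rewrite ffunE].
move=> u' [Uu' eu']; apply/ffunP=> g; rewrite ffunE; apply/eqP.
rewrite -subr_eq0; apply/eqP; apply: (un (fun g => u g - u' g)).
  by move=> h; apply: subspaceB.
by rewrite sumrB eu' subrr.
Qed.

Lemma direct_sum_ex (W : set V) (U : G -> set V) w : direct_sum W U -> W w ->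
  exists u : G -> V, (forall g, U g (u g)) /\ w = \sum_g u g.
Proof. by move=> [_ _ ds] /ds[u [Pu _]]; exists u. Qed.

Lemma direct_sum_inj (W : set V) (U : G -> set V) (u v : G -> V) :
    direct_sum W U -> W (\sum_g u g) ->
    (forall g, U g (u g)) -> (forall g, U g (v g)) ->
  \sum_g u g = \sum_g v g -> u =1 v.
Proof.
move=> [_ _ ds] /ds[z [_ zu]] Uu Uv e g.
have P f : f = u \/ f = v -> z = [ffun g => f g].
  move=> f_uv; apply: zu; split.
    by move=> h; rewrite ffunE; case: f_uv => ->.
  have -> : \sum_g u g = \sum_g f g by case: f_uv => ->.
  by apply: eq_bigr => h _; rewrite ffunE.
have := P v (or_intror erefl); rewrite (P u (or_introl erefl)).
by move/ffunP/(_ g); rewrite !ffunE.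
Qed.

End DirectSum.

(* MathComp rings are unital, hence a bespoke structure *)
Record gradedAlg (F : fieldType) (G : finGroupType) := GradedAlg {
  gsort :> lmodType F;
  gmul : gsort -> gsort -> gsort;
  gcomp : G -> set gsort;
  gmulA : associative gmul;
  gmul_linearl : forall b, linear (gmul^~ b);
  gmul_linearr : forall a, linear (gmul a);
  gcomp_direct : direct_sum setT gcomp;
  gcompM : forall g h a b,
    gcomp g a -> gcomp h b -> gcomp (g * h)%g (gmul a b)
}.

Arguments gmul {F G A} a b : rename.
Arguments gcomp {F G} A g _ : rename.

Section GradedAlgebras.
Variables (F : fieldType) (G : finGroupType).
Implicit Types A B : gradedAlg F G.

Definition graded_subspace A (W : set A) : Prop :=
  subspace W /\ direct_sum W (fun g => W `&` gcomp A g).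

Definition subalgebra A (B : set A) : Prop :=
  subspace B /\ forall a b, B a -> B b -> B (gmul a b).

Definition graded_subalgebra A (B : set A) : Prop :=
  graded_subspace B /\ subalgebra B.

Definition graded_ideal A (I : set A) : Prop :=
  graded_subspace I /\ forall a x, I x -> I (gmul a x) /\ I (gmul x a).

Definition graded_hom A B (f : {linear A -> B}) : Prop :=
  {morph f : a b / gmul a b} /\ forall g a, gcomp A g a -> gcomp B g (f a).

Definition graded_iso A B : Prop :=
  exists f : {linear A -> B}, graded_hom f /\ bijective f.

Definition finitely_generated A : Prop :=
  exists S : set A, finite_set S /\ smallest (@subalgebra A) S = setT.

End GradedAlgebras.

Section Subalgebra.
Variables (F : fieldType) (G : finGroupType) (A : gradedAlg F G) (B : set A).
Hypothesis hB : graded_subalgebra B.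

Definition subalg_sort of graded_subalgebra B : Type := {x | x \in B}.
Local Notation S := (subalg_sort hB).

HB.instance Definition _ := SubChoice.copy S {x | x \in B}.

Fact subalg_closed : GRing.subsemimod_closed [in B].
Proof. exact: GRing.submod_closed_semi hB.1.1. Qed.

HB.instance Definition _ :=
  GRing.SubChoice_isSubLmodule.Build F A [in B] S subalg_closed.

Fact subalg_mul_subproof (a b : S) : gmul (val a) (val b) \in B.
Proof. by rewrite inE; apply: hB.2.2; rewrite -inE; exact: valP. Qed.

Definition subalg_mul (a b : S) : S := Sub (gmul (val a) (val b)) (subalg_mul_subproof a b).

Definition subalg_comp (g : G) : set S := [set a | gcomp A g (val a)].

Fact subalg_mulE a b : val (subalg_mul a b) = gmul (val a) (val b).
Proof. exact: SubK. Qed.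

Fact subalg_valP (c : F) (x y : S) : val (c *: x + y) = c *: val x + val y.
Proof. exact: linearP. Qed.

Fact subalg_val0 : val (0 : S) = 0.
Proof. exact: (linear0 (val : {linear S -> A})). Qed.

Fact subalg_val_sum (u : G -> S) : val (\sum_g u g) = \sum_g val (u g).
Proof. exact: (linear_sum (val : {linear S -> A})). Qed.

Fact subalg_mulA : associative subalg_mul.
Proof. by move=> a b c; apply: val_inj; rewrite !subalg_mulE gmulA. Qed.

Fact subalg_mul_linearl b : linear (subalg_mul^~ b).
Proof.
move=> c x y; apply: val_inj.
by rewrite !(subalg_mulE, subalg_valP) gmul_linearl.
Qed.

Fact subalg_mul_linearr a : linear (subalg_mul a).
Proof.
move=> c x y; apply: val_inj.
by rewrite !(subalg_mulE, subalg_valP) gmul_linearr.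
Qed.

Fact subalg_comp_direct : direct_sum setT subalg_comp.
Proof.
have [sA _ _] := gcomp_direct A.
apply: direct_sumI => //.
- move=> g; apply/subspaceP; have /subspaceP[A0 Al] := sA g.
  split; first by rewrite /subalg_comp /mkset subalg_val0.
  move=> c u v Au Av; rewrite /subalg_comp /mkset subalg_valP; exact: Al.
- move=> w _; have /(direct_sum_ex hB.1.2)[u [Bu e]] : B (val w).
    exact: set_mem (valP w).
  have Bu' g : u g \in B by rewrite inE; exact: (Bu g).1.
  exists (fun g => Sub (u g) (Bu' g) : S); split.
    by move=> g; rewrite /subalg_comp /mkset SubK; exact: (Bu g).2.
  apply: val_inj; rewrite subalg_val_sum e.
  by apply: eq_bigr => g _; rewrite SubK.
- move=> u Uu e g; apply: val_inj; rewrite subalg_val0.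
  apply: (direct_sum_inj (u := fun g => val (u g)) (v := fun=> 0)
            (gcomp_direct A)) => //.
    by move=> h; have /subspaceP[] := sA h.
  by rewrite -subalg_val_sum e subalg_val0 big1.
Qed.

Fact subalg_compM g h a b : subalg_comp g a -> subalg_comp h b ->
  subalg_comp (g * h)%g (subalg_mul a b).
Proof. by rewrite /subalg_comp /mkset subalg_mulE; exact: gcompM. Qed.

Definition subalg : gradedAlg F G := GradedAlg
  subalg_mulA subalg_mul_linearl subalg_mul_linearr
  subalg_comp_direct subalg_compM.

End Subalgebra.

Section Quotient.
Variables (F : fieldType) (G : finGroupType) (A : gradedAlg F G) (I : set A).
Hypothesis hI : graded_ideal I.

Definition ideal_pred of graded_ideal I : {pred A} := [in I].

Fact ideal_pred_closed : GRing.submod_closed (ideal_pred hI).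
Proof. exact: hI.1.1. Qed.

HB.instance Definition _ :=
  GRing.isSubmodClosed.Build F A (ideal_pred hI) ideal_pred_closed.

Definition quot_sort : Type := Quotient.quot (ideal_pred hI).
Local Notation Q := quot_sort.

HB.instance Definition _ := GRing.Zmodule.on Q.

Definition quot_pi (x : A) : Q := \pi_(Quotient.quot (ideal_pred hI)) x.

Fact quot_piP (x y : A) : quot_pi x = quot_pi y <-> I (x - y).
Proof.
split=> [/eqP|xy]; last apply/eqP.
  by rewrite -Quotient.idealrBE => /set_mem.
by rewrite -Quotient.idealrBE; apply: mem_set.
Qed.

Fact quot_pi_surj (q : Q) : exists x, q = quot_pi x.
Proof. by exists (repr q); rewrite /quot_pi reprK. Qed.

Fact quot_piD : {morph quot_pi : x y / x + y}.
Proof. exact: (@pi_addr _ _ _ _ _ (Quotient.quot (ideal_pred hI))). Qed.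

Fact quot_pi0 : quot_pi 0 = 0.
Proof. exact: (@pi_zeror _ _ _ _ _ (Quotient.quot (ideal_pred hI))). Qed.

Fact quot_pi_sum (u : G -> A) : quot_pi (\sum_g u g) = \sum_g quot_pi (u g).
Proof. exact: (big_morph _ quot_piD quot_pi0). Qed.

Definition quot_scale (c : F) (q : Q) : Q := quot_pi (c *: repr q).
Definition quot_mul (p q : Q) : Q := quot_pi (gmul (repr p) (repr q)).
Definition quot_comp (g : G) : set Q := quot_pi @` gcomp A g.

Fact quot_repr (x : A) : I (repr (quot_pi x) - x).
Proof. by apply/quot_piP; rewrite /quot_pi reprK. Qed.

Fact quot_piZ c : {morph quot_pi : x / c *: x >-> quot_scale c x}.
Proof.
move=> x; apply/quot_piP; rewrite -scalerBr -opprB scalerN -scaleNr.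
have /subspaceP[I0 Il] := hI.1.1.
by rewrite -[X in I X]addr0; apply: Il => //; apply: quot_repr.
Qed.

Fact quot_piM : {morph quot_pi : x y / gmul x y >-> quot_mul x y}.
Proof.
move=> x y; apply/esym/quot_piP.
set x' := repr _; set y' := repr _.
have -> : gmul x' y' - gmul x y = gmul (x' - x) y' + gmul x (y' - y).
  rewrite -[x' - x]addrC -[y' - y]addrC -!scaleN1r.
  by rewrite gmul_linearl gmul_linearr addrC addrACA !scaleN1r addNr addr0 addrC.
have Ix := quot_repr x; have Iy := quot_repr y.
have /subspaceP[I0 Il] := hI.1.1.
rewrite -[gmul (x' - x) _]scale1r; apply: Il.
  exact: (hI.2 _ _ Ix).2.
exact: (hI.2 _ _ Iy).1.
Qed.

Fact quot_scaleA a b q : quot_scale a (quot_scale b q) = quot_scale (a * b) q.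
Proof. by have [x ->] := quot_pi_surj q; rewrite -!quot_piZ scalerA. Qed.

Fact quot_scale1 : left_id 1 quot_scale.
Proof. by move=> q; have [x ->] := quot_pi_surj q; rewrite -quot_piZ scale1r. Qed.

Fact quot_scaleDr : right_distributive quot_scale +%R.
Proof.
move=> a p q; have [x ->] := quot_pi_surj p; have [y ->] := quot_pi_surj q.
by rewrite -quot_piD -!quot_piZ -quot_piD scalerDr.
Qed.

Fact quot_scaleDl q : {morph quot_scale^~ q : a b / a + b}.
Proof.
move=> a b /=; have [x ->] := quot_pi_surj q.
by rewrite -!quot_piZ -quot_piD scalerDl.
Qed.

HB.instance Definition _ := GRing.Zmodule_isLmodule.Build F Q
  quot_scaleA quot_scale1 quot_scaleDr quot_scaleDl.

Fact quot_piL c x y : quot_pi (c *: x + y) = c *: quot_pi x + quot_pi y.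
Proof. by rewrite quot_piD quot_piZ. Qed.

Fact quot_mulA : associative quot_mul.
Proof.
move=> p q r; have [x ->] := quot_pi_surj p; have [y ->] := quot_pi_surj q.
by have [z ->] := quot_pi_surj r; rewrite -!quot_piM gmulA.
Qed.

Fact quot_mul_linearl b : linear (quot_mul^~ b).
Proof.
move=> c p q; have [x ->] := quot_pi_surj p; have [y ->] := quot_pi_surj q.
have [z ->] := quot_pi_surj b.
by rewrite -quot_piL -!quot_piM gmul_linearl quot_piL.
Qed.

Fact quot_mul_linearr a : linear (quot_mul a).
Proof.
move=> c p q; have [x ->] := quot_pi_surj p; have [y ->] := quot_pi_surj q.
have [z ->] := quot_pi_surj a.
by rewrite -quot_piL -!quot_piM gmul_linearr quot_piL.
Qed.

Fact quot_comp_direct : direct_sum setT quot_comp.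
Proof.
have dA := gcomp_direct A; have [sA _ _] := dA.
apply: direct_sumI => //.
- move=> g; apply/subspaceP; have /subspaceP[A0 Al] := sA g.
  split; first by exists 0 => //; exact: quot_pi0.
  move=> c _ _ [x Ax <-] [y Ay <-].
  by exists (c *: x + y); [exact: Al | exact: quot_piL].
- move=> q _; have [x ->] := quot_pi_surj q.
  have [u [Au ->]] := direct_sum_ex dA (Logic.I : setT x).
  exists (fun g => quot_pi (u g)); split; last exact: quot_pi_sum.
  by move=> g; exists (u g).
- move=> u Qu e g.
  have {Qu} /choice[a Pa] : forall h, exists x, gcomp A h x /\ quot_pi x = u h.
    by move=> h; have [x] := Qu h; exists x.
  have Ia : I (\sum_h a h).
    rewrite -[X in I X]subr0; apply/quot_piP; rewrite quot_pi_sum quot_pi0 -[RHS]e.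
    by apply: eq_bigr => h _; rewrite (Pa h).2.
  have [c [Ic ec]] := direct_sum_ex hI.1.2 Ia.
  have ac : a g = c g.
    apply: (direct_sum_inj dA) ec g => //.
      by move=> h; exact: (Pa h).1.
    by move=> h; exact: (Ic h).2.
  rewrite -(Pa g).2 -quot_pi0; apply/quot_piP.
  by rewrite subr0 ac; exact: (Ic g).1.
Qed.

Fact quot_compM g h p q : quot_comp g p -> quot_comp h q ->
  quot_comp (g * h)%g (quot_mul p q).
Proof.
move=> [x Ax <-] [y Ay <-].
by exists (gmul x y); [exact: gcompM | exact: quot_piM].
Qed.

Definition quot : gradedAlg F G := GradedAlg
  quot_mulA quot_mul_linearl quot_mul_linearr quot_comp_direct quot_compM.

End Quotient.

Section FreeAlgebra.
Variables (F : fieldType) (G : finGroupType).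

(* (g, i) stands for the variable x_i^(g) *)
Definition gvar : Type := (G * nat)%type.
HB.instance Definition _ := Choice.on gvar.

Definition word_deg (w : {fmonom gvar}) : G := (\prod_(x <- w) x.1)%g.

(* {malg F[{fmonom gvar}]} is the free unital algebra; the free algebra is
   its subspace of polynomials without constant term *)
Definition no_const : {pred {malg F[{fmonom gvar}]}} :=
  [pred f | f@_(mone : {fmonom gvar}) == 0].

Definition free_sort : Type := {f | f \in no_const}.
Local Notation P := free_sort.

HB.instance Definition _ := SubChoice.copy P {f | f \in no_const}.

Fact no_const_closed : GRing.subsemimod_closed no_const.
Proof.
apply: GRing.submod_closed_semi; split=> [|c f h]; rewrite !inE ?mcoeff0 //.
by move=> /eqP f0 /eqP h0; rewrite mcoeffD mcoeffZ f0 h0 mulr0 addr0.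
Qed.

HB.instance Definition _ :=
  GRing.SubChoice_isSubLmodule.Build F {malg F[{fmonom gvar}]} no_const P
    no_const_closed.

Fact free_mul_subproof (f h : P) : val f * val h \in no_const.
Proof.
have := valP f; rewrite !inE => /eqP f0.
by rewrite (mcoeff1g_is_multiplicative _ _).1 f0 mul0r.
Qed.

Definition free_mul (f h : P) : P :=
  Sub (val f * val h) (free_mul_subproof f h).

Definition free_comp (g : G) : set P :=
  [set f | forall w, w \in msupp (val f) -> word_deg w = g].

Fact free_mulE f h : val (free_mul f h) = val f * val h.
Proof. exact: SubK. Qed.

Fact free_valL (c : F) (f h : P) : val (c *: f + h) = c *: val f + val h.
Proof. exact: linearP. Qed.

Fact free_val0 : val (0 : P) = 0.
Proof. exact: (linear0 (val : {linear P -> {malg F[{fmonom gvar}]}})). Qed.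

Fact free_val_sum (u : G -> P) : val (\sum_g u g) = \sum_g val (u g).
Proof. exact: (linear_sum (val : {linear P -> {malg F[{fmonom gvar}]}})). Qed.

Fact free_mulA : associative free_mul.
Proof. by move=> f h k; apply: val_inj; rewrite !free_mulE mulrA. Qed.

Fact free_mul_linearl k : linear (free_mul^~ k).
Proof.
move=> c f h; apply: val_inj.
by rewrite !(free_mulE, free_valL) mulrDl scalerAl.
Qed.

Fact free_mul_linearr k : linear (free_mul k).
Proof.
move=> c f h; apply: val_inj.
rewrite !(free_mulE, free_valL) mulrDr; congr (_ + _).
apply/malgP => w; rewrite mcoeffZ.
rewrite (mcoeffMlw w (fsubset_refl (msupp (val k))) (msuppZ_le c (val f))).
rewrite mcoeffMl mulr_sumr; apply: eq_bigr => u _.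
rewrite mulr_sumr; apply: eq_bigr => v _.
by rewrite mcoeffZ mulrCA mulrnAr.
Qed.

Definition free_part (f : {malg F[{fmonom gvar}]}) (g : G) :
    {malg F[{fmonom gvar}]} :=
  [malg w in msupp f => if word_deg w == g then f@_w else 0].

Fact free_partE f g w :
  (free_part f g)@_w = if word_deg w == g then f@_w else 0.
Proof. by rewrite mcoeffE; case: msuppP => //; rewrite if_same. Qed.

Fact free_part_no_const (f : P) g : free_part (val f) g \in no_const.
Proof. by have := valP f; rewrite !inE free_partE => /eqP->; rewrite if_same. Qed.

Fact free_compE g (f : P) :
  free_comp g f <-> forall w, word_deg w != g -> (val f)@_w = 0.
Proof.
split=> [fg w|fg w wf].
  by case: msuppP => // /fg ->; rewrite eqxx.
apply/eqP; apply: contraT => /fg /eqP.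
by rewrite mcoeff_eq0 wf.
Qed.

Fact free_comp_direct : direct_sum setT free_comp.
Proof.
apply: direct_sumI => //.
- move=> g; apply/subspaceP; split.
    by apply/free_compE => w _; rewrite free_val0 mcoeff0.
  move=> c f h /free_compE fg /free_compE hg; apply/free_compE => w wg.
  by rewrite free_valL mcoeffD mcoeffZ fg // hg // mulr0 addr0.
- move=> f _.
  exists (fun g => Sub (free_part (val f) g) (free_part_no_const f g) : P).
  split=> [g|].
    by apply/free_compE => w wg; rewrite SubK free_partE (negbTE wg).
  apply: val_inj; rewrite free_val_sum; apply/malgP => w.
  rewrite raddf_sum /= (bigD1 (word_deg w)) //= free_partE eqxx.
  rewrite big1 ?addr0 // => g wg.
  by rewrite free_partE eq_sym (negbTE wg).
- move=> u Pu e g; apply: val_inj; rewrite free_val0; apply/malgP => w.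
  rewrite mcoeff0; have [wg|wg] := eqVneq (word_deg w) g; last first.
    by have /free_compE -> := Pu g.
  have : (val (\sum_g u g))@_w = 0 by rewrite e free_val0 mcoeff0.
  rewrite free_val_sum raddf_sum (bigD1 g) //= big1 ?addr0 //.
  by move=> h hg; have /free_compE -> := Pu h; rewrite // wg eq_sym.
Qed.

Fact word_degM v w : word_deg (mmul v w) = (word_deg v * word_deg w)%g.
Proof. by rewrite /word_deg fmM big_cat. Qed.

Fact free_compM g h a b : free_comp g a -> free_comp h b ->
  free_comp (g * h)%g (free_mul a b).
Proof.
move=> ag bh w; rewrite free_mulE => /msuppM_le[u [v [ua vb ->]]].
by rewrite word_degM (ag _ ua) (bh _ vb).
Qed.

(* F<X_G> *)
Definition freeAlg : gradedAlg F G := GradedAlg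
  free_mulA free_mul_linearl free_mul_linearr free_comp_direct free_compM.

End FreeAlgebra.

Section Identities.
Variables (F : fieldType) (G : finGroupType).
Implicit Types A B : gradedAlg F G.
Local Notation FX := (freeAlg F G).

(* The empty word does not occur in elements of F<X_G>; its value is junk *)
Definition word_eval A (v : gvar G -> A) (w : seq (gvar G)) : A :=
  if w is x :: s then foldl (fun a y => gmul a (v y)) (v x) s else 0.

Definition eval A (v : gvar G -> A) (f : FX) : A :=
  \sum_(w <- msupp (val f)) (val f)@_w *: word_eval v w.

Definition graded_identity A (f : FX) : Prop :=
  forall v : gvar G -> A, (forall x, gcomp A x.1 (v x)) -> eval v f = 0.

Definition T_G A : set FX := [set f | graded_identity A f].

Definition TG_ideal (I : set FX) : Prop :=
  graded_ideal I /\
  forall (phi : {linear FX -> FX}), graded_hom phi -> phi @` I `<=` I.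

(* Varieties are classes of algebras, too large to have type [set _] *)
Definition variety_of (S : set FX) A : Prop := S `<=` T_G A.

Definition var A : gradedAlg F G -> Prop := variety_of (T_G A).

Definition variety_gen (K : gradedAlg F G -> Prop) : gradedAlg F G -> Prop :=
  variety_of [set f | forall A, K A -> T_G A f].

Variant proper_graded_section A : gradedAlg F G -> Prop :=
  ProperGradedSection (B : set A) (hB : graded_subalgebra B)
      (C : set (subalg hB)) (hC : graded_ideal C) of
      ~ (B = setT /\ C = [set 0]) :
    proper_graded_section A (quot hC).

Definition critical A : Prop :=
  finite_set [set: A] /\ ~ variety_gen (proper_graded_section A) A.

Definition locally_finite (V : gradedAlg F G -> Prop) : Prop :=
  forall A, V A -> finitely_generated A -> finite_set [set: A].

Definition finitely_based (V : gradedAlg F G -> Prop) : Prop :=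
  exists S : set FX, finite_set S /\ forall A, V A <-> variety_of S A.

Definition finitely_many_critical (V : gradedAlg F G -> Prop) : Prop :=
  exists (n : nat) (L : 'I_n -> gradedAlg F G),
    forall A, V A -> critical A -> exists i, graded_iso A (L i).

Definition Cross (V : gradedAlg F G -> Prop) : Prop :=
  [/\ locally_finite V, finitely_based V & finitely_many_critical V].

End Identities.

(* Main.v *)
Require Import Defs.
From HB Require Import structures.
From mathcomp Require Import all_boot all_fingroup all_algebra.
From mathcomp Require Import generic_quotient finmap.
From mathcomp Require Import boolp classical_sets cardinality.
From mathcomp Require Import monalg.

(* Let [n] bound the cardinality of [A].  Two finite families of identities of
   [A] suffice.  The first says that a product interleaving arbitrary elements
   with all the differences [x_i - x_j], [i < j <= n], of elements of one degree
   vanishes; hence a graded-prime algebra satisfying it has at most [n] elements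
   in each degree.  As an infinite finitely generated algebra over a finite field
   has a just infinite quotient, which would be prime, the variety is locally
   finite.  The second family equates words of length [n + 1] with combinations of
   longer words, so the nilpotent ideals have bounded class.

   Let [B] be a critical algebra satisfying both and [J] a maximal nilpotent
   graded ideal.  If [B] is generated by pieces none of which can be omitted, and
   every product involving all the pieces is zero, then inclusion-exclusion shows
   that [B] lies in the variety of its proper subalgebras.  Applied to the
   preimages of the minimal ideals of [B / J], and then to elements of [J], this
   bounds the number of generators of [B].  So there are finitely many critical
   algebras; they determine the subvarieties, and [var A] is cut out by finitely
   many further identities. *)

Set Implicit Arguments.
Unset Strict Implicit.
Unset Printing Implicit Defensive.

Import GRing.Theory.

Local Open Scope classical_set_scope.
Local Open Scope ring_scope.

(** * Graded algebras *)

(** Whatever bounds a critical algebra may depend on [n] and [G] only, never on the algebra; hence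
    all nilpotent graded ideals first receive a common class. The first family of identities comes
    from the pigeonhole principle in [A]. The second comes from an idempotent. In the relatively
    free algebra of [A], [n + 1] homogeneous variables generate a subalgebra that is finite by the
    first family; let [e] be a principal idempotent of it, of degree 1. Degree-1 elements of the
    corner cut out by [1 - e] are nilpotent, so in [A] a product of [n + 1] factors
    [(1 - e) x_i (1 - e)] vanishes. As [e] equals all its powers, it lifts to polynomials of any
    prescribed order, and the factors differ from the [x_i] by long words only.

    Two obstacles shape the arguments. There is no unit: [1 - e] is written out, products carry a
    last factor, and a middle factor cannot be set to 1. And there is the grading: primeness is
    tested on homogeneous elements, and idempotents are wanted in degree 1; a homogeneous element
    that fixes a nonzero homogeneous element does have degree 1. *)

Section GradedBasics.
Variables (F : fieldType) (G : finGroupType).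

(** Products, components and evaluations carry their linearity as a proposition; bundling it gives
    access to the general lemmas on linear maps. *)
Definition linpack (U V : lmodType F) (h : U -> V) (hl : linear h) :
    {linear U -> V} :=
  HB.pack h (GRing.isLinear.Build F U V *:%R h hl).

Section Linear.
Variables (U V : lmodType F) (h : U -> V).
Hypothesis hl : linear h.

Lemma lin0 : h 0 = 0.
Proof. exact: (linear0 (linpack hl)). Qed.

Lemma linB : {morph h : x y / x - y}.
Proof. exact: (linearB (linpack hl)). Qed.

Lemma linZ c x : h (c *: x) = c *: h x.
Proof. exact: (linearZZ (linpack hl)). Qed.

Lemma lin_sum (J : Type) (r : seq J) (P : pred J) (u : J -> U) :
  h (\sum_(i <- r | P i) u i) = \sum_(i <- r | P i) h (u i).
Proof. exact: (linear_sum (linpack hl)). Qed.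

End Linear.

Variable A : gradedAlg F G.
Implicit Types (x y a b : A) (W X I : set A).

Lemma gmul0l a : gmul 0 a = 0.
Proof. exact: (linear0 (linpack (gmul_linearl a))). Qed.

Lemma gmul0r a : gmul a 0 = 0.
Proof. exact: (linear0 (linpack (gmul_linearr a))). Qed.

Lemma gmulDl a b c : gmul (a + b) c = gmul a c + gmul b c.
Proof. exact: (linearD (linpack (gmul_linearl c))). Qed.

Lemma gmulDr a b c : gmul a (b + c) = gmul a b + gmul a c.
Proof. exact: (linearD (linpack (gmul_linearr a))). Qed.

Lemma gmulBl a b c : gmul (a - b) c = gmul a c - gmul b c.
Proof. exact: (linearB (linpack (gmul_linearl c))). Qed.

Lemma gmulBr a b c : gmul a (b - c) = gmul a b - gmul a c.
Proof. exact: (linearB (linpack (gmul_linearr a))). Qed.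

Lemma gmulZl k a b : gmul (k *: a) b = k *: gmul a b.
Proof. exact: (linearZZ (linpack (gmul_linearl b))). Qed.

Lemma gmulZr k a b : gmul a (k *: b) = k *: gmul a b.
Proof. exact: (linearZZ (linpack (gmul_linearr a))). Qed.

Lemma gmul_suml (J : Type) (r : seq J) (P : pred J) (u : J -> A) b :
  gmul (\sum_(i <- r | P i) u i) b = \sum_(i <- r | P i) gmul (u i) b.
Proof. exact: (linear_sum (linpack (gmul_linearl b))). Qed.

Lemma gmul_sumr (J : Type) (r : seq J) (P : pred J) (u : J -> A) a :
  gmul a (\sum_(i <- r | P i) u i) = \sum_(i <- r | P i) gmul a (u i).
Proof. exact: (linear_sum (linpack (gmul_linearr a))). Qed.

Lemma subspace0 W : subspace W -> W 0.
Proof. by case/subspaceP. Qed.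

Lemma subspaceL W c x y : subspace W -> W x -> W y -> W (c *: x + y).
Proof. by case/subspaceP=> _; apply. Qed.

Lemma subspaceZ W c x : subspace W -> W x -> W (c *: x).
Proof.
by move=> sW Wx; rewrite -[_ *: _]addr0; apply: subspaceL => //; apply: subspace0.
Qed.

Lemma subspaceD W x y : subspace W -> W x -> W y -> W (x + y).
Proof. by move=> sW Wx Wy; rewrite -[x]scale1r; apply: subspaceL. Qed.

Lemma subspace_sumP W (J : Type) (r : seq J) (P : pred J) (u : J -> A) :
  subspace W -> (forall i, P i -> W (u i)) -> W (\sum_(i <- r | P i) u i).
Proof.
move=> sW Wu; elim/big_rec: _ => [|i x Pi Wx]; first exact: subspace0.
by apply: subspaceD => //; apply: Wu.
Qed.

Lemma subspace_gcomp g : subspace (gcomp A g).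
Proof. by case: (gcomp_direct A). Qed.

Lemma gcomp0 g : gcomp A g 0.
Proof. exact: subspace0 (subspace_gcomp g). Qed.

Lemma gproj_ex x :
  exists u : G -> A, (forall g, gcomp A g (u g)) /\ x = \sum_g u g.
Proof. exact: direct_sum_ex (gcomp_direct A) (Logic.I : setT x). Qed.

Definition gproj x (g : G) : A := projT1 (cid (gproj_ex x)) g.

Lemma gprojP x g : gcomp A g (gproj x g).
Proof. by rewrite /gproj; case: cid => u []. Qed.

Lemma gproj_sum x : x = \sum_g gproj x g.
Proof. by rewrite /gproj; case: cid => u []. Qed.

Lemma gproj_unique x (u : G -> A) :
  (forall g, gcomp A g (u g)) -> x = \sum_g u g -> gproj x =1 u.
Proof.
move=> Au xu; apply: (direct_sum_inj (gcomp_direct A)) => //.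
  exact: gprojP.
by rewrite -gproj_sum.
Qed.

Lemma gprojL c x y g : gproj (c *: x + y) g = c *: gproj x g + gproj y g.
Proof.
rewrite (@gproj_unique _ (fun g => c *: gproj x g + gproj y g)) //.
  by move=> h; apply: subspaceL (subspace_gcomp h) _ _; apply: gprojP.
by rewrite big_split /= -scaler_sumr -!gproj_sum.
Qed.

Lemma gproj_sumE (J : Type) (r : seq J) (P : pred J) (u : J -> A) g :
  gproj (\sum_(i <- r | P i) u i) g = \sum_(i <- r | P i) gproj (u i) g.
Proof. exact: (linear_sum (linpack (fun c x y => gprojL c x y g))). Qed.

Lemma gproj_hom h x g : gcomp A h x -> gproj x g = if g == h then x else 0.
Proof.
move=> Ax; rewrite (@gproj_unique _ (fun g => if g == h then x else 0)) //.
  by move=> k; case: eqP => [->|_] //; apply: gcomp0.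
by rewrite -big_mkcond big_pred1_eq.
Qed.

Lemma gproj0 g : gproj 0 g = 0.
Proof. by rewrite (gproj_hom g (gcomp0 g)) eqxx. Qed.

Lemma gproj_mul x y g :
  gproj (gmul x y) g = \sum_h gmul (gproj x h) (gproj y (h^-1 * g)%g).
Proof.
rewrite (@gproj_unique _ (fun g => \sum_h gmul (gproj x h) (gproj y (h^-1 *
  g)%g))) //.
  move=> k; apply: subspace_sum (subspace_gcomp k) _ => h.
  by rewrite -{1}[k](mulKVg h); apply: gcompM; apply: gprojP.
rewrite {1}[x]gproj_sum {1}[y]gproj_sum gmul_suml exchange_big /=.
apply: eq_bigr => h _; rewrite gmul_sumr (reindex_inj (mulgI h^-1)%g) /=.
by apply: eq_bigr.
Qed.

Lemma gcomp_inj g h x : gcomp A g x -> gcomp A h x -> x != 0 -> g = h.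
Proof.
move=> gx hx; apply: contra_neq_eq => gh.
by have := gproj_hom g gx; rewrite eqxx (gproj_hom g hx) (negbTE gh).
Qed.

Lemma graded_subspaceP W :
  graded_subspace W <-> subspace W /\ forall x g, W x -> W (gproj x g).
Proof.
split=> -[sW dW]; split=> //.
  move=> x g Wx; have [u [Wu e]] := direct_sum_ex dW Wx.
  by rewrite (gproj_unique _ e) => [|h]; [exact: (Wu g).1 | exact: (Wu h).2].
apply: direct_sumI.
- move=> g; apply/subspaceP; split=> [|c u v [Wu gu] [Wv gv]].
    by split; [exact: subspace0 | exact: gcomp0].
  by split; apply: subspaceL => //; apply: subspace_gcomp.
- by move=> g x [].
- move=> w Ww; exists (gproj w); split; last exact: gproj_sum.
  by move=> g; split; [exact: dW | exact: gprojP].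
- move=> u Wu e g; have := gproj0 g.
  by rewrite (gproj_unique (u := u)) // => h; exact: (Wu h).2.
Qed.

Definition homog x := exists g, gcomp A g x.

Definition ideal I :=
  subspace I /\ forall a x, I x -> I (gmul a x) /\ I (gmul x a).

Lemma graded_ideal_ideal I : graded_ideal I -> ideal I.
Proof. by case=> [[]]. Qed.

Lemma graded_ideal_proj I x g : graded_ideal I -> I x -> I (gproj x g).
Proof. by case=> /graded_subspaceP[_ h] _; apply: h. Qed.

Lemma graded_idealP I :
  graded_ideal I <-> ideal I /\ forall x g, I x -> I (gproj x g).
Proof.
split=> [hI|[[sI mI] pI]].
  by split=> [|x g]; [exact: graded_ideal_ideal | exact: graded_ideal_proj].
by split=> //; apply/graded_subspaceP.
Qed.

(* The largest graded subspace of [I]; passing to it spares all degree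
   computations when an annihilator is to be replaced by a graded one. *)
Definition core I := [set x | forall g, I (gproj x g)].

Lemma core_graded I : ideal I -> graded_ideal (core I).
Proof.
move=> [sI mI]; split.
  apply/graded_subspaceP; split.
    apply/subspaceP; split=> [|c u v Iu Iv] g.
      by rewrite gproj0; apply: subspace0.
    by rewrite gprojL; apply: subspaceL.
  move=> x g Ix h; rewrite (gproj_hom _ (gprojP x g)).
  by case: eqP => // _; apply: subspace0.
move=> a x Ix; split=> g; rewrite gproj_mul; apply: subspace_sum => // h.
  exact: (mI _ _ (Ix _)).1.
exact: (mI _ _ (Ix _)).2.
Qed.

Lemma core_sub I : subspace I -> core I `<=` I.
Proof. by move=> sI x Ix; rewrite [x]gproj_sum; apply: subspace_sum. Qed.

Lemma core_hom I x : subspace I -> homog x -> I x -> core I x.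
Proof.
move=> sI [g gx] Ix h; rewrite (gproj_hom h gx).
by case: eqP => // _; apply: subspace0.
Qed.

Inductive span X : set A :=
| span0 : span X 0
| spanS c x y : X x -> span X y -> span X (c *: x + y).

Lemma span_sub X W : subspace W -> X `<=` W -> span X `<=` W.
Proof.
move=> sW XW x; elim=> [|c u v Xu _ Wv]; first exact: subspace0.
by apply: subspaceL => //; apply: XW.
Qed.

Lemma sub_span X : X `<=` span X.
Proof. by move=> x Xx; rewrite -[x]scale1r -[_ *: x]addr0; apply: spanS => //;
  apply: span0. Qed.

Lemma span_subspace X : subspace (span X).
Proof.
apply/subspaceP; split=> [|c u v Xu Xv]; first exact: span0.
elim: Xu => [|k x y Xx Xy IH]; first by rewrite scaler0 add0r.
by rewrite scalerDr scalerA -addrA; apply: spanS.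
Qed.

Lemma span_mono X X' : X `<=` X' -> span X `<=` span X'.
Proof.
by move=> XX'; apply: span_sub (span_subspace _) _ => x /XX' /sub_span.
Qed.

Lemma subspaceI W W' : subspace W -> subspace W' -> subspace (W `&` W').
Proof.
move=> sW sW'; apply/subspaceP; split=> [|c u v [? ?] [? ?]].
  by split; apply: subspace0.
by split; apply: subspaceL.
Qed.

Lemma graded_idealI I J :
  graded_ideal I -> graded_ideal J -> graded_ideal (I `&` J).
Proof.
move=> /graded_idealP[[sI mI] pI] /graded_idealP[[sJ mJ] pJ].
apply/graded_idealP; split; first split; first exact: subspaceI.
  by move=> a x [Ix Jx]; have [? ?] := mI a _ Ix; have [? ?] := mJ a _ Jx.
by move=> x g [Ix Jx]; split; [apply: pI | apply: pJ].
Qed.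

Lemma subspace_preim (B : gradedAlg F G) (h : A -> B) (W : set B) :
  linear h -> subspace W -> subspace (h @^-1` W).
Proof.
move=> hl sW; apply/subspaceP; rewrite /preimage /mkset; split=> [|c u v Wu Wv].
  by rewrite (lin0 hl); case/subspaceP: sW.
by rewrite (hl c u v); case/subspaceP: sW => _; apply.
Qed.

Definition gen X : set A := smallest (@subalgebra F G A) X.

Lemma gen_subalgebra X : subalgebra (gen X).
Proof.
split.
  apply/subspaceP; split=> [W [[sW _] _]|c u v Xu Xv W WX].
    exact: subspace0.
  by apply: subspaceL; [exact: WX.1.1 | exact: Xu | exact: Xv].
by move=> a b Xa Xb W WX; apply: WX.1.2; [exact: Xa | exact: Xb].
Qed.

Lemma sub_gen X : X `<=` gen X.
Proof. exact: sub_gen_smallest. Qed.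

Lemma gen_min X W : subalgebra W -> X `<=` W -> gen X `<=` W.
Proof. exact: smallest_sub. Qed.

Lemma gen_mono X X' : X `<=` X' -> gen X `<=` gen X'.
Proof.
by move=> XX'; apply: gen_min (gen_subalgebra _) _ => x /XX' /sub_gen.
Qed.

(** The elements all of whose components lie in [gen X] form a subalgebra containing [X], by the
    convolution formula [gproj_mul]. *)
Lemma gen_graded X : X `<=` homog -> graded_subalgebra (gen X).
Proof.
move=> homX; have [sX mX] := gen_subalgebra X; split=> //.
apply/graded_subspaceP; split=> // x g Xx; move: x Xx g.
apply: gen_min => [|x Xx g]; last first.
  have [h hx] := homX x Xx; rewrite (gproj_hom _ hx).
  by case: eqP => _; [exact: sub_gen | exact: subspace0].
split.
  apply/subspaceP; split=> [g|c u v Xu Xv g].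
    by rewrite gproj0; apply: subspace0.
  by rewrite gprojL; apply: (subspaceL _ sX).
by move=> a b Xa Xb g; rewrite gproj_mul; apply: subspace_sum sX _ => h;
  apply: mX.
Qed.

End GradedBasics.

(** * Evaluation of graded polynomials *)

Section FreeEval.
Variables (F : fieldType) (G : finGroupType).
Local Notation FX := (freeAlg F G).
Local Notation word := {fmonom (gvar G)}.

Section WordEval.
Variable A : gradedAlg F G.
Implicit Types (v : gvar G -> A) (w : seq (gvar G)).

(** Both words must be nonempty: the empty word evaluates to 0, not to a unit. *)
Lemma word_eval_cat v w w' : w != [::] -> w' != [::] ->
  word_eval v (w ++ w') = gmul (word_eval v w) (word_eval v w').
Proof.
case: w w' => [|x s] [|y t] // _ _; rewrite /word_eval /= foldl_cat /=.
set a := foldl _ (v x) s; elim/last_ind: t => [//|t z IH].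
by rewrite !foldl_rcons IH gmulA.
Qed.

Lemma word_eval_in v w (D : set A) : D 0 ->
  (forall a b, D a -> D b -> D (gmul a b)) -> (forall x, D (v x)) ->
  D (word_eval v w).
Proof.
move=> D0 mD Dv; case: w => // x s /=.
by elim/last_ind: s => [|s y IH]; rewrite ?foldl_rcons //=; apply: mD.
Qed.

Lemma word_eval_ext v v' w : {in w, v =1 v'} -> word_eval v w = word_eval v' w.
Proof.
case: w => // x s e /=; rewrite (e x) ?mem_head //.
elim/last_ind: s e => [//|s y IH] e; rewrite !foldl_rcons IH => [|z].
  by rewrite (e y) // inE mem_rcons inE eqxx orbT.
by rewrite inE => zs; apply: e; rewrite inE mem_rcons inE orbCA zs orbT.
Qed.

Lemma word_eval_gcomp v w : (forall x, gcomp A x.1 (v x)) ->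
  gcomp A (\prod_(x <- w) x.1)%g (word_eval v w).
Proof.
move=> gv; case: w => [|x s] /=; first exact: gcomp0.
elim/last_ind: s => [|s y IH]; first by rewrite big_seq1.
by rewrite foldl_rcons -cats1 -cat_cons big_cat big_seq1; apply: gcompM.
Qed.

(** Evaluation on the ambient unital algebra, where a product can be split into single monomials; a
    constant term contributes 0. *)
Definition evm v (f : {malg F[word]}) : A :=
  \sum_(w <- msupp f) f@_w *: word_eval v w.

Lemma evmEw v f (d : {fset word}) : (msupp f `<=` d)%fset ->
  evm v f = \sum_(w <- d) f@_w *: word_eval v w.
Proof.
move=> fd; rewrite /evm (big_fset_incl _ fd) //= => w _ /mcoeff_outdom ->.
by rewrite scale0r.
Qed.

Lemma evm_linear v : linear (evm v).
Proof.
move=> c f h; set d := (msupp f `|` msupp h)%fset.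
have fd : (msupp f `<=` d)%fset by apply: fsubsetUl.
have hd : (msupp h `<=` d)%fset by apply: fsubsetUr.
rewrite (evmEw v fd) (evmEw v hd) (@evmEw v _ d).
  rewrite scaler_sumr -big_split /=; apply: eq_bigr => w _.
  by rewrite mcoeffD mcoeffZ scalerDl scalerA.
apply: fsubset_trans (msuppD_le _ _) _; apply: fsetSU; exact: msuppZ_le.
Qed.

Lemma evmU v c (w : word) : evm v << c *g w >> = c *: word_eval v w.
Proof. by rewrite (evmEw v msuppU_le) big_seq_fset1 mcoeffUU. Qed.

End WordEval.

Lemma supp_nonempty (f : FX) (w : word) : w \in msupp (val f) ->
  w != [::] :> seq _.
Proof.
move=> wf; apply/eqP => w0; have := valP f; rewrite inE.
have -> : mone = w :> word by apply/eqP; rewrite fmP w0 fm1.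
by rewrite mcoeff_eq0 wf.
Qed.

Section Eval.
Variable A : gradedAlg F G.
Implicit Types (v : gvar G -> A) (f : FX).

Lemma eval_linear v : linear (eval v).
Proof. by move=> c f h; rewrite /eval free_valL; apply: evm_linear. Qed.

Lemma evalM v : {morph eval v : f h / gmul f h}.
Proof.
move=> f h; rewrite /eval (free_mulE f h) -/(evm v _) malgME.
rewrite (lin_sum (evm_linear v)) gmul_suml big_seq [RHS]big_seq.
apply: eq_bigr => w1 w1f; rewrite (lin_sum (evm_linear v)) gmul_sumr.
rewrite big_seq [RHS]big_seq; apply: eq_bigr => w2 w2h.
rewrite evmU fmM word_eval_cat ?(supp_nonempty w1f) ?(supp_nonempty w2h) //.
by rewrite gmulZl gmulZr scalerA.
Qed.

Lemma eval_in v f (D : set A) : subalgebra D -> (forall x, D (v x)) ->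
  D (eval v f).
Proof.
move=> [sD mD] Dv; rewrite /eval; apply: subspace_sumP => // w _.
by apply: subspaceZ => //; apply: word_eval_in => //; apply: subspace0.
Qed.

Definition fvars f : seq (gvar G) :=
  flatten (map (fun w : word => fmonom_val w) (msupp (val f))).

Lemma eval_ext v v' f : {in fvars f, v =1 v'} -> eval v f = eval v' f.
Proof.
move=> e; rewrite /eval big_seq [RHS]big_seq; apply: eq_bigr => w wf.
congr (_ *: _); apply: word_eval_ext => x xw; apply: e.
by apply/flattenP; exists (w : seq _) => //; apply/mapP; exists w.
Qed.

Lemma eval_gcomp v f g : (forall x, gcomp A x.1 (v x)) -> gcomp FX g f ->
  gcomp A g (eval v f).
Proof.
move=> gv fg; rewrite /eval big_seq.
apply: subspace_sumP (subspace_gcomp A g) _ => w wf.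
apply: subspaceZ (subspace_gcomp A g) _; rewrite -(fg w wf).
exact: word_eval_gcomp.
Qed.

End Eval.

Section Hom.
Variables (A B : gradedAlg F G) (h : A -> B).
Hypothesis hl : linear h.

Lemma hom_gproj : (forall g a, gcomp A g a -> gcomp B g (h a)) ->
  forall x g, gproj (h x) g = h (gproj x g).
Proof.
move=> hg x g; rewrite (gproj_unique (u := fun g => h (gproj x g))) //.
  by move=> k; apply: hg; apply: gprojP.
by rewrite {1}(gproj_sum x) (lin_sum hl).
Qed.

Lemma hom_eval v f : {morph h : a b / gmul a b} -> h (eval v f) = eval (h \o v) f.
Proof.
move=> hM; rewrite /eval (lin_sum hl); apply: eq_bigr => w _.
rewrite (linZ hl); congr (_ *: _); case: w => -[|x s] /=; first exact: lin0.
by elim/last_ind: s => [//|s y IH]; rewrite !foldl_rcons hM IH.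
Qed.

End Hom.

Lemma eval_gproj (A : gradedAlg F G) (v : gvar G -> A) (f : FX) g :
  (forall x, gcomp A x.1 (v x)) -> gproj (eval v f) g = eval v (gproj f g).
Proof.
move=> gv; apply: (hom_gproj (eval_linear v)) => k a ka; exact: eval_gcomp.
Qed.

Lemma fmu_neq1 (x : gvar G) : fmu x != mone :> word.
Proof. by rewrite fmP fmU fm1. Qed.

Fact fvar_no_const (x : gvar G) : << fmu x >> \in @no_const F G.
Proof. by rewrite inE mcoeffU (negbTE (fmu_neq1 x)). Qed.

Definition fvar (x : gvar G) : FX := Sub << fmu x >> (fvar_no_const x).

Lemma val_fvar x : val (fvar x) = << fmu x >>.
Proof. exact: SubK. Qed.

Lemma val_word_eval_fvar (w : word) : w != [::] :> seq _ ->
  val (word_eval fvar w) = << w >>.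
Proof.
case: w => -[//|x s] _; elim/last_ind: s => [|s y IH].
  by rewrite -[in RHS]fmuE; apply: val_fvar.
rewrite /word_eval /= foldl_rcons; apply: etrans (free_mulE _ _) _.
rewrite (IH : val _ = _) val_fvar malgM_def fgmulUU mulr1; congr (mkmalgU _ _);
  apply/eqP.
by rewrite fmP fmM fmU /= cats1.
Qed.

Lemma eval_fvar (f : FX) : eval fvar f = f.
Proof.
apply: val_inj; rewrite /eval.
have lv : linear (val : FX -> {malg F[word]}) by move=> c a b; apply: free_valL.
rewrite (lin_sum lv) [RHS]monalgE big_seq [RHS]big_seq.
apply: eq_bigr => w wf;
  rewrite (linZ lv) val_word_eval_fvar ?(supp_nonempty wf) //.
by apply/malgP => k; rewrite mcoeffZ !mcoeffU mulrnAr mulr1.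
Qed.

Lemma eval_var (A : gradedAlg F G) (v : gvar G -> A) x : eval v (fvar x) = v x.
Proof.
by rewrite /eval val_fvar -/(evm v _) evmU scale1r fmU.
Qed.

Lemma fvar_gcomp x : gcomp FX x.1 (fvar x).
Proof.
by move=> w; rewrite val_fvar msuppU1 inE => /eqP ->;
  rewrite /word_deg fmU big_seq1.
Qed.

(** The order of a polynomial, as for power series: for [k > 0] this is the [k]th power of the free
    algebra. *)
Definition ford k (f : FX) := forall w, w \in msupp (val f) -> (k <= size w)%N.

Lemma ford_le k l f : (k <= l)%N -> ford l f -> ford k f.
Proof. by move=> kl fl w /fl; apply: leq_trans. Qed.

Lemma fordP k f : ford k f <-> forall w : word, (size w < k)%N -> (val f)@_w = 0.
Proof.
split=> fk w; first by rewrite ltnNge => /negP kw; apply: mcoeff_outdom;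
  apply/negP => /fk.
by rewrite -mcoeff_neq0 leqNgt; apply: contraNN => /fk/eqP.
Qed.

Lemma ford_subspace k : subspace (ford k).
Proof.
apply/subspaceP; split=> [|c f h /fordP fk /fordP hk]; apply/fordP => w wk.
  by rewrite free_val0 mcoeff0.
by rewrite free_valL mcoeffD mcoeffZ fk // hk // mulr0 addr0.
Qed.

Lemma fordM k l f h : ford k f -> ford l h -> ford (k + l) (gmul f h).
Proof.
move=> fk hl w; rewrite (free_mulE f h) => /msuppM_le[u [u' [uf uh ->]]].
by rewrite fmM size_cat leq_add ?fk ?hl.
Qed.

Lemma ford1 f : ford 1 f.
Proof. by move=> w /supp_nonempty; case: (w : seq _). Qed.

End FreeEval.

(** * Varieties and T_G-ideals *)

Section Varieties.
Variables (F : fieldType) (G : finGroupType).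
Local Notation FX := (freeAlg F G).
Implicit Types A B : gradedAlg F G.

Definition graded_val A (v : gvar G -> A) := forall x, gcomp A x.1 (v x).

(** Expresses identities of a subalgebra by valuations in [A] itself, which spares the subtype later
    on. *)
Lemma identity_sub A (D : set A) (hD : graded_subalgebra D) f :
  T_G (subalg hD) f <->
  forall v : gvar G -> A, graded_val v -> (forall x, D (v x)) -> eval v f = 0.
Proof.
have vl : linear (val : subalg hD -> A) by exact: subalg_valP.
have vM : {morph (val : subalg hD -> A) : a b / gmul a b}.
  by move=> a b; exact: subalg_mulE.
split=> [idf v gv Dv|idf v gv].
  have Dv' x : v x \in D by apply/mem_set.
  pose u x : subalg hD := Sub (v x) (Dv' x).
  have -> : eval v f = val (eval u f).
    by rewrite (hom_eval vl _ _ vM); apply: eval_ext => x _; rewrite [RHS]SubK.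
  rewrite (_ : eval u f = 0); first exact: lin0.
  apply: idf => x; suff : gcomp A x.1 (val (u x)) by [].
  by rewrite SubK.
apply: val_inj; rewrite (hom_eval vl _ _ vM) [RHS](lin0 vl); apply: idf => x.
  exact: gv.
by apply/set_mem; exact: valP.
Qed.

Lemma variety_sub S A (D : set A) (hD : graded_subalgebra D) :
  variety_of S A -> variety_of S (subalg hD).
Proof. by move=> SA f /SA idf; apply/identity_sub => v gv _; apply: idf. Qed.

Lemma quot_lift A (I : set A) (hI : graded_ideal I) (v : gvar G -> quot hI) :
  graded_val v ->
  exists2 p : gvar G -> A, graded_val p & v = quot_pi hI \o p.
Proof.
move=> gv; have /choice[p hp] x : exists a, gcomp A x.1 a /\ quot_pi hI a = v x.
  by have [a] := gv x; exists a.
by exists p => [x|]; [have [] := hp x | apply/funext => x; have [] := hp x].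
Qed.

Lemma quot_pi_linear A (I : set A) (hI : graded_ideal I) :
  linear (quot_pi hI : A -> quot hI).
Proof. exact: quot_piL. Qed.

Lemma quot_pi_mul A (I : set A) (hI : graded_ideal I) :
  {morph (quot_pi hI : A -> quot hI) : a b / gmul a b}.
Proof. exact: quot_piM. Qed.

Lemma quot_eval A (I : set A) (hI : graded_ideal I) (p : gvar G -> A) (f : FX) :
  eval (A := quot hI) (quot_pi hI \o p) f = quot_pi hI (eval p f).
Proof.
by rewrite (@hom_eval _ _ A (quot hI)) //; [exact: quot_piL | exact: quot_piM].
Qed.

Lemma quot_pi_eq0 A (I : set A) (hI : graded_ideal I) x :
  quot_pi hI x = 0 <-> I x.
Proof. by rewrite -(quot_pi0 hI) quot_piP subr0. Qed.

Lemma variety_quot S A (I : set A) (hI : graded_ideal I) :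
  variety_of S A -> variety_of S (quot hI).
Proof.
move=> SA f /SA idf v /quot_lift[p gp ->]; rewrite quot_eval.
by rewrite (idf p gp) quot_pi0.
Qed.

Definition Id (K : gradedAlg F G -> Prop) : set FX :=
  [set f | forall A, K A -> T_G A f].

Lemma TG_ideal_T_G A : TG_ideal (T_G A).
Proof.
split.
  apply/graded_idealP; split; first split.
  - apply/subspaceP; split=> [v _|c f h fA hA v gv].
      exact: lin0 (eval_linear v).
    by rewrite eval_linear fA // hA // scaler0 addr0.
  - move=> a f fA; split=> v gv; rewrite evalM fA //.
      exact: gmul0r.
    exact: gmul0l.
  - by move=> f g fA v gv; rewrite -eval_gproj // fA // gproj0.
move=> phi [phiM phig] _ [f fA <-] v gv.
have phil : linear phi by exact: linearP.
rewrite -(eval_fvar f) (hom_eval phil) // (hom_eval (eval_linear v)).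
  by apply: fA => x; apply: eval_gcomp => //; apply: phig; apply: fvar_gcomp.
exact: evalM.
Qed.

Lemma TG_ideal_bigcap (J : Type) (P : set J) (T : J -> set FX) :
  (forall j, P j -> TG_ideal (T j)) -> TG_ideal (\bigcap_(j in P) T j).
Proof.
move=> hT; split.
  apply/graded_idealP; split; first split.
  - apply/subspaceP; split=> [j /hT[] /graded_ideal_ideal[/subspaceP[]]//|].
    move=> c f h fT hT' j Pj; have [/graded_ideal_ideal[sT _] _] := hT j Pj.
    by apply: subspaceL => //; [apply: fT | apply: hT'].
  - move=> a f fT; split=> j Pj; have [[_ /(_ a f (fT j Pj))[]]] := hT j Pj => //.
  - move=> f g fT j Pj; have [gT _] := hT j Pj.
    by apply: graded_ideal_proj => //; apply: fT.
move=> phi hphi _ [f fT <-] j Pj; have [_ /(_ phi hphi)] := hT j Pj.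
by apply; exists f => //; apply: fT.
Qed.

Lemma TG_ideal_Id K : TG_ideal (Id K).
Proof.
(* The intersection is indexed by ideals, since the algebras of [K] form a class too large for
   [set]. *)
rewrite (_ : Id K = \bigcap_(T in [set T | exists A, K A /\ T = T_G A]) T).
  by apply: TG_ideal_bigcap => _ [A [_ ->]]; apply: TG_ideal_T_G.
apply/seteqP; split=> f Kf; first by move=> _ [A [KA ->]]; apply: Kf.
by move=> A KA; apply: Kf; exists A.
Qed.

Lemma TG_ideal_smallest (S : set FX) : TG_ideal (smallest (@TG_ideal F G) S).
Proof. by apply: (@TG_ideal_bigcap _ _ id) => T []. Qed.

Lemma TG_ideal_eval (T : set FX) (p : gvar G -> FX) f :
  TG_ideal T -> graded_val p -> T f -> T (eval p f).
Proof.
move=> [_ hT] gp Tf; apply: (hT (linpack (eval_linear p))); last by exists f.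
by split=> [a b|g a ga]; [exact: evalM | exact: eval_gcomp].
Qed.

(** A graded valuation in the quotient lifts to one in the free algebra, that is, to a graded
    endomorphism, and [T] is stable under it. *)
Lemma relfree_variety (T S : set FX) (hT : TG_ideal T) : S `<=` T ->
  variety_of S (quot hT.1).
Proof.
move=> ST f /ST Tf v /quot_lift[p gp ->]; rewrite quot_eval.
by apply/quot_pi_eq0; apply: TG_ideal_eval.
Qed.

Lemma relfree_identity (T : set FX) (hT : TG_ideal T) f :
  T_G (quot hT.1) f -> T f.
Proof.
move=> /(_ (quot_pi hT.1 \o @fvar F G)); rewrite quot_eval eval_fvar.
move=> e; apply/(quot_pi_eq0 hT.1); apply: e => x.
by exists (fvar F x) => //; apply: fvar_gcomp.
Qed.

(** Every consequence of [S] can be deduced from [S]: the free algebra modulo the ideal generated by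
    [S] lies in the variety, and there a consequence vanishes at the images of the variables. *)
Lemma smallest_TG_ideal (S : set FX) :
  smallest (@TG_ideal F G) S = Id (variety_of S).
Proof.
apply/seteqP; split.
  by apply: smallest_sub (TG_ideal_Id _) _ => f Sf A; apply.
move=> f idf; have hT := TG_ideal_smallest S;
  apply: (relfree_identity (hT := hT)).
apply: idf; apply: relfree_variety => //; exact: sub_gen_smallest.
Qed.

Lemma T_G_basis A (S : set FX) : (forall B, var A B <-> variety_of S B) ->
  T_G A = smallest (@TG_ideal F G) S.
Proof.
move=> AS; rewrite smallest_TG_ideal; apply/seteqP; split=> f.
  by move=> fA B /AS; apply.
by apply; apply/AS.
Qed.

Lemma proper_sub_identity A (D : set A) (hD : graded_subalgebra D) f v :
  (forall B, proper_graded_section A B -> T_G B f) -> D != setT ->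
  graded_val v -> (forall x, D (v x)) -> eval v f = 0.
Proof.
move=> idf DT gv Dv.
(* A subalgebra becomes a section only through its quotient by the zero ideal. *)
have h0 : graded_ideal [set (0 : subalg hD)].
  apply/graded_idealP; split; first split.
  - by apply/subspaceP; split=> // c _ _ -> ->; rewrite /= scaler0 addr0.
  - by move=> a _ ->; rewrite gmul0l gmul0r.
  - by move=> _ g ->; exact: gproj0.
have /idf idq : proper_graded_section A (quot h0).
  by apply: ProperGradedSection => -[DT' _]; rewrite DT' eqxx in DT.
apply: (identity_sub hD f).1 gv Dv => u gu; apply/(quot_pi_eq0 h0).
rewrite -quot_eval; apply: idq => x; exists (u x) => //; exact: gu.
Qed.

End Varieties.

(** * A criterion for non-criticality *)

Section NotCritical.
Variables (F : fieldType) (G : finGroupType) (B : gradedAlg F G) (I : finType).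
Variable lett : option I -> set B.
Implicit Types (o : option I) (U T W : {set I}) (a b x : B).

Definition tagset o : {set I} := if o is Some i then [set i]%SET else finset.set0.

(** Products of letters, indexed by the exact set of tags that occur; letters of [lett None] carry
    no tag and survive every restriction. *)
Inductive mon : {set I} -> B -> Prop :=
| mon_lett o x : lett o x -> mon (tagset o) x
| mon_cons o a U b : lett o a -> mon U b -> mon (tagset o :|: U) (gmul a b).

Lemma monM U a T b : mon U a -> mon T b -> mon (U :|: T) (gmul a b).
Proof.
move=> Ua Tb; elim: Ua => [o x ox|o c W d oc _ IH]; first exact: mon_cons.
by rewrite -gmulA -finset.setUA; apply: mon_cons.
Qed.

Definition spmon U := span (mon U).

Lemma spmonM U a T b : spmon U a -> spmon T b -> spmon (U :|: T) (gmul a b).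
Proof.
have sUT := span_subspace (mon (U :|: T)).
elim=> [|c x y Ux _ IH] Tb; first by rewrite gmul0l; apply: subspace0.
rewrite gmul_linearl; apply: subspaceL => //; last exact: IH.
elim: Tb => [|d z t Tz _ IHb]; first by rewrite gmul0r; apply: subspace0.
by rewrite gmul_linearr; apply: subspaceL => //; apply: sub_span; apply: monM.
Qed.

(* [beta T] is what remains of an element of [B] once the letters with tag
   outside [T] are set to zero in some expression for it. *)
Definition good (beta : {set I} -> B) := exists m : {set I} -> B,
  (forall U, spmon U (m U)) /\ forall T,
    beta T = \sum_(U : {set I} | U \subset T) m U.

Lemma good_ext beta beta' : beta =1 beta' -> good beta -> good beta'.
Proof. by move=> e [m [Pm em]]; exists m; split=> // T; rewrite -e. Qed.

Lemma good0 : good (fun=> 0).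
Proof. by exists (fun=> 0); split=> [U|T]; [exact: span0 | rewrite big1]. Qed.

Lemma goodL c beta beta' : good beta -> good beta' ->
  good (fun T => c *: beta T + beta' T).
Proof.
move=> [m [Pm e]] [m' [Pm' e']]; exists (fun U => c *: m U + m' U); split.
  by move=> U; apply: subspaceL => //; apply: span_subspace.
by move=> T; rewrite e e' big_split /= scaler_sumr.
Qed.

Lemma goodM beta beta' : good beta -> good beta' ->
  good (fun T => gmul (beta T) (beta' T)).
Proof.
move=> [m [Pm e]] [m' [Pm' e']].
(* Terms are collected by the union of their tag sets, which lies in [T] exactly when both sets
   do. *)
exists (fun W => \sum_(p : {set I} * {set I} | p.1 :|: p.2 == W)
   gmul (m p.1) (m' p.2)); split.
  move=> W; apply: subspace_sumP (span_subspace _) _ => p /eqP <-.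
  exact: spmonM.
move=> T; rewrite e e' gmul_suml; under eq_bigr do rewrite gmul_sumr.
rewrite pair_big (partition_big (fun p => p.1 :|: p.2)
  (fun W : {set I} => W \subset T)) /=; last by move=> p; rewrite finset.subUset.
apply: eq_bigr => W WT; apply: eq_bigl => p.
by rewrite -finset.subUset; case: eqP => [->|_]; rewrite ?WT ?andbF.
Qed.

Lemma good_sum (J : Type) (r : seq J) (c : J -> F) (beta : J -> {set I} -> B) :
  (forall j, good (beta j)) -> good (fun T => \sum_(j <- r) c j *: beta j T).
Proof.
move=> gb; elim: r => [|j r IH].
  by apply: good_ext good0 => T; rewrite big_nil.
by apply: good_ext (goodL (c j) (gb j) IH) => T; rewrite big_cons.
Qed.

Lemma good_eval (beta : gvar G -> {set I} ->
  B) f : (forall x : gvar G, good (beta x)) ->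
  good (fun T => eval (beta^~ T) f).
Proof.
move=> gb; apply: good_sum => -[[|x s]]; first exact: good0.
elim/last_ind: s => [|s y IH]; first exact: gb.
by apply: good_ext (goodM IH (gb y)) => T; rewrite /word_eval /= foldl_rcons.
Qed.

Lemma good_lett o x : lett o x ->
  good (fun T => if tagset o \subset T then x else 0).
Proof.
move=> ox; exists (fun U => if U == tagset o then x else 0); split.
  move=> U; case: eqP => [->|_]; last exact: span0.
  by apply: sub_span; apply: mon_lett.
move=> T; rewrite -big_mkcondr /=; case: ifP => oT.
  rewrite (big_pred1 (tagset o)) // => U /=.
  by case: eqP => [->|_]; rewrite ?oT ?andbF.
by rewrite big_pred0 // => U; case: eqP => [->|_]; rewrite ?oT ?andbF.
Qed.

Hypothesis lett_hom : forall o, lett o `<=` @homog F G B.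

(** Monomials in homogeneous letters are homogeneous, so taking a component merely drops some of
    them. This makes the restricted valuations graded for every [T]. *)
Lemma good_gproj beta g : good beta -> good (fun T => gproj (beta T) g).
Proof.
move=> [m [Pm e]]; exists (fun U => gproj (m U) g); split.
  move=> U; elim: (Pm U) => [|c x y Ux _ IH]; first by rewrite gproj0;
    apply: span0.
  rewrite gprojL; have [h hx] : homog x.
    elim: Ux => [o z /lett_hom //|o z W t /lett_hom [k kz] _ [l lt]].
    by exists (k * l)%g; apply: gcompM.
  rewrite (gproj_hom g hx); case: eqP => _; first exact: spanS.
  by rewrite scaler0 add0r.
by move=> T; rewrite e gproj_sumE.
Qed.

Hypothesis lett_gen : gen (\bigcup_o lett o) = setT.

Lemma good_lift b : exists beta, good beta /\ beta [set: I]%SET = b.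
Proof.
have : gen (\bigcup_o lett o) b by rewrite lett_gen.
apply: (gen_min (W := [set b | exists beta, good beta /\ beta [set: I]%SET = b])).
  split.
    apply/subspaceP; split=> [|c u v [b1 [g1 e1]] [b2 [g2 e2]]].
      by exists (fun=> 0); split=> //; apply: good0.
    by exists (fun T => c *: b1 T + b2 T); rewrite e1 e2; split=> //;
      apply: goodL.
  move=> u v [b1 [g1 e1]] [b2 [g2 e2]].
  by exists (fun T => gmul (b1 T) (b2 T)); rewrite e1 e2; split=> //;
    apply: goodM.
move=> x [o _ ox]; exists (fun T => if tagset o \subset T then x else 0).
by split; [exact: good_lett | rewrite finset.subsetT].
Qed.

Hypothesis lett_proper : forall i,
  gen (\bigcup_(o in [set o | o <> Some i]) lett o) <> setT.
Hypothesis mon_full : forall x, mon [set: I]%SET x -> x = 0.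

Lemma spmon_gen U i x : i \notin U -> spmon U x ->
  gen (\bigcup_(o in [set o | o <> Some i]) lett o) x.
Proof.
have [sgen mgen] := gen_subalgebra (\bigcup_(o in [set o | o <> Some i]) lett o).
move=> iU; apply: span_sub => // {}x Ux.
elim: Ux iU => [o y oy|o y W z oy _ IH].
  by move=> io; apply: sub_gen; exists o => // eo;
    rewrite eo /= finset.set11 in io.
rewrite finset.in_setU negb_or => /andP[io iW]; apply: mgen; last exact: IH.
by apply: sub_gen; exists o => // eo; rewrite eo /= finset.set11 in io.
Qed.

(** Lift the valuation to [gam] and set letters to zero. For [T] proper the values lie in a proper
    subalgebra, where [f] vanishes; so all partial sums of [m] over subsets of such [T] are zero.
    What remains of the value of [f] is the term [m] of the full tag set, a combination of products
    involving every piece. *)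
Lemma variety_proper_sections : variety_gen (proper_graded_section B) B.
Proof.
move=> f idf v gv.
have /choice[beta hb] (x : gvar G) : exists beta,
  good beta /\ beta [set: I]%SET = v x.
  exact: good_lift.
pose gam (x : gvar G) T := gproj (beta x T) x.1.
have ggam (x : gvar G) : good (gam x) by apply: good_gproj; have [] := hb x.
have gamT (x : gvar G) : gam x [set: I]%SET = v x.
  by rewrite /gam (hb x).2 (gproj_hom _ (gv x)) eqxx.
have [m [Pm em]] := good_eval f ggam.
have ev0 T : T != [set: I]%SET -> eval (gam^~ T) f = 0.
  rewrite -finset.subTset => /subsetPn[i _ iT].
  have hD : graded_subalgebra (gen (\bigcup_(o in [set o | o <> Some i]) lett o)).
    by apply: gen_graded => x [o _ /lett_hom].
  apply: (proper_sub_identity hD idf); first exact/eqP.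
    by move=> x; apply: gprojP.
  move=> x; have [m' [Pm' e']] := ggam x; rewrite e'.
  apply: subspace_sumP => [|U UT]; first by case: hD => _ [].
  by apply: spmon_gen (Pm' U); apply: contra iT; apply/fintype.subsetP.
(* Moebius inversion over subsets, carried out as an induction on [#|U|]. *)
have m0 U : U != [set: I]%SET -> m U = 0.
  have [n] := ubnP #|U|; elim: n U => // n IH U Un UT.
  have := em U; rewrite ev0 // (bigD1 U) //= big1 ?addr0 // => W /andP[WU nWU].
  have WU' : W \proper U by rewrite finset.properEneq nWU.
  apply: IH; first exact: leq_trans (proper_card WU') _.
  by rewrite -finset.properT;
    apply: fintype.proper_sub_trans WU' (finset.subsetT U).
rewrite (@eval_ext _ _ _ _ (gam^~ [set: I]%SET)) => [|x _]; last by rewrite gamT.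
rewrite em (bigD1 [set: I]%SET) //= big1 => [|U /andP[_ UT]]; last exact: m0.
rewrite addr0; elim: (Pm [set: I]%SET) => // c x y Ux _ ->.
by rewrite (mon_full Ux) scaler0 addr0.
Qed.

Lemma not_critical : ~ critical B.
Proof. by case=> _; apply; apply: variety_proper_sections. Qed.

End NotCritical.

(** * The discriminator identities *)

(** The list may have repetitions, so a surjective image inherits the bound at once. *)
Definition fcard (T : eqType) (n : nat) :=
  exists2 s : seq T, (size s <= n)%N & forall x, x \in s.

Lemma fcard_finite (T : eqType) n : fcard T n -> finite_set [set: T].
Proof.
case=> s _ sT; apply/finite_seqP; exists s.
by apply/seteqP; split=> x // _; apply: sT.
Qed.

Lemma finite_fcard (T : eqType) : finite_set [set: T] -> exists n, fcard T n.
Proof.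
move=> /finite_seqP[s sT]; exists (size s); exists s => // x.
by have : [set: T] x by []; rewrite sT.
Qed.

Lemma fcard_bound (T : eqType) n (s : seq T) : fcard T n -> uniq s ->
  (size s <= n)%N.
Proof.
move=> [t tn tT] us; apply: leq_trans tn; exact: uniq_leq_size.
Qed.

Lemma fcard_pigeonhole (T : eqType) n (X : nat -> T) : fcard T n ->
  exists i j, (i < j <= n)%N /\ X i = X j.
Proof.
move=> Tn; have : ~~ uniq (mkseq X n.+1).
  by apply/negP => /(fcard_bound Tn); rewrite size_mkseq ltnn.
move=> /(uniqPn (X 0%N))[i [j []]]; rewrite size_mkseq => ij jn.
rewrite !nth_mkseq // ?(ltn_trans ij) // => e.
by exists i, j; rewrite ij -ltnS jn.
Qed.

Lemma map_zip_snd (S T U : Type) (h : T -> U) (s : seq S) (t : seq T) :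
  [seq (q.1, h q.2) | q <- zip s t] = zip s (map h t).
Proof. by elim: s t => [|x s IH] [|y t] //=; rewrite IH. Qed.

Section Discriminator.
Variables (F : fieldType) (G : finGroupType).
Local Notation FX := (freeAlg F G).
Implicit Types A : gradedAlg F G.

Definition dprod (A : gradedAlg F G) (X : nat -> A) (a : A)
    (s : seq ((nat * nat) * A)) : A :=
  foldl (fun b q => gmul (gmul b q.2) (X q.1.1 - X q.1.2)) a s.

Lemma dprod0 A (X : nat -> A) s : dprod X 0 s = 0.
Proof. by elim: s => //= q s IH; rewrite !gmul0l. Qed.

Lemma dprod_eq0 A (X : nat -> A) a s p : p \in unzip1 s -> X p.1 = X p.2 ->
  dprod X a s = 0.
Proof.
move=> ps e; elim: s a ps => //= q s IH a; rewrite inE => /orP[/eqP <-|/IH] //.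
by rewrite e subrr gmul0r dprod0.
Qed.

Lemma eval_dprod A (v : gvar G -> A) (X : nat -> FX) a s :
  eval v (dprod X a s) =
  dprod (eval v \o X) (eval v a) [seq (q.1, eval v q.2) | q <- s].
Proof.
elim: s a => //= q s IH a; rewrite /dprod /= -/(dprod _ _ _) IH.
by rewrite !evalM (linB (eval_linear v)).
Qed.

Lemma dprod_ext A (X X' : nat -> A) a s : X =1 X' -> dprod X a s = dprod X' a s.
Proof. by move=> e; elim: s a => //= q s IH a; rewrite IH !e. Qed.

Definition pairs m : seq (nat * nat) :=
  [seq p <- [seq (i, j) | i <- iota 0 m.+1, j <- iota 0 m.+1] | (p.1 < p.2)%N].

Lemma mem_pairs m i j : ((i, j) \in pairs m) = (i < j <= m)%N.
Proof.
rewrite mem_filter -[(_.1 < _)%N]/(i < j)%N.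
have [ij|//] := boolP (i < j)%N.
rewrite !andTb; apply/allpairsPdep/idP => [[a [b []]]|jm].
  by rewrite !mem_iota => _ /andP[_ +] [_ ->]; rewrite add0n ltnS.
exists i, j; rewrite !mem_iota !add0n !ltnS jm; split=> //.
exact: leq_trans (ltnW ij) jm.
Qed.

(* The value of [y_0 y_1 (x_i - x_j) y_2 (x_i' - x_j') ...], the product being
   over all [i < j <= m], vanishes in any algebra with at most [m] elements. *)
Definition dpoly m (g : G) (es : seq G) : FX :=
  let y k := fvar F (nth 1%g es k, k.*2.+1) in
  dprod (fun i => fvar F (g, i.*2)) (y 0%N)
    (zip (pairs m) (mkseq (fun k => y k.+1) (size (pairs m)))).

Lemma eval_dpoly A (v : gvar G -> A) m g es :
  let y k := v (nth 1%g es k, k.*2.+1) in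
  eval v (dpoly m g es) = dprod (fun i => v (g, i.*2)) (y 0%N)
    (zip (pairs m) (mkseq (fun k => y k.+1) (size (pairs m)))).
Proof.
rewrite /dpoly eval_dprod eval_var (@dprod_ext _ _ (fun i => v (g, i.*2))).
  congr dprod; rewrite map_zip_snd /mkseq -map_comp; congr zip.
  by apply: eq_map => k; apply: eval_var.
by move=> i; apply: eval_var.
Qed.

(** One polynomial for each choice of degrees; finiteness of [G] keeps the family finite. *)
Definition dset m : set FX :=
  range (fun q : G * (size (pairs m)).+1.-tuple G => dpoly m q.1 q.2).

Lemma finite_dset m : finite_set (dset m).
Proof. exact: finite_image. Qed.

Lemma dset_identity m (A : gradedAlg F G) : fcard A m -> variety_of (dset m) A.
Proof.
move=> Am _ [[g es] _ <-] v gv; rewrite eval_dpoly.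
have [i [j [ij e]]] := fcard_pigeonhole (fun i => v (g, i.*2)) Am.
apply: (@dprod_eq0 _ _ _ _ (i, j)) => //.
by rewrite unzip1_zip ?size_mkseq // mem_pairs.
Qed.

Section Prime.
Variables (B : gradedAlg F G) (M : set B).
Hypothesis hM : graded_ideal M.
Hypothesis primM : forall a b, M a -> M b -> homog a -> homog b ->
  a != 0 -> b != 0 -> exists2 y, homog y & gmul (gmul a y) b != 0.

(** Primeness supplies, between the nonzero product built so far and the next difference, a
    homogeneous factor that keeps it nonzero; the product stays homogeneous and in [M], so this can
    be repeated. *)
Lemma dprod_neq0 (g : G) (X : nat -> B) a (l : seq (nat * nat)) :
    (forall i, gcomp B g (X i)) ->
    {in l, forall p, M (X p.1 - X p.2) /\ X p.1 - X p.2 != 0} ->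
    M a -> homog a -> a != 0 ->
  exists ys (es : seq G), [/\ size ys = size l, size es = size l,
    forall k, gcomp B (nth 1%g es k) (nth 0 ys k) & dprod X a (zip l ys) != 0].
Proof.
move=> gX; elim: l a => [|p l IH] a hl Ma ha a0.
  by exists [::], [::]; split=> // k; rewrite !nth_nil; apply: gcomp0.
have [Md d0] := hl p (mem_head _ _).
have hd : gcomp B g (X p.1 - X p.2) by apply: subspaceB (subspace_gcomp B g) _ _.
have [y [e ey] ay0] := primM Ma Md ha (ex_intro _ g hd) a0 d0.
have [||||ys [es [sys ses hys nz]]] := IH (gmul (gmul a y) (X p.1 - X p.2)).
- by move=> q ql; apply: hl; rewrite inE ql orbT.
- by have [_ /(_ (gmul a y) _ Md)[]] := hM.
- have [h ah] := ha; exists (h * e * g)%g; do 2!apply: gcompM => //.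
- by [].
exists (y :: ys), (e :: es); split; rewrite /= ?sys ?ses //.
by case.
Qed.

(** With more than [m] elements all the differences are nonzero, and [dprod_neq0] yields a nonzero
    value of some [dpoly]. It serves twice: for [M] the whole of a just infinite algebra and for [M]
    a minimal ideal. *)
Lemma prime_bound m g (xs : seq B) : (0 < m)%N -> variety_of (dset m) B ->
  uniq xs -> {in xs, forall x, M x /\ gcomp B g x} -> (size xs <= m)%N.
Proof.
move=> m0 Bm uxs Mxs; rewrite leqNgt; apply/negP => mxs.
pose X i := nth 0 xs i.
have sM : subspace M by have [[]] := hM.
have MX i : M (X i) /\ gcomp B g (X i).
  have [ix|ix] := ltnP i (size xs); first by apply: Mxs; apply: mem_nth.
  by rewrite /X nth_default //; split; [exact: subspace0 | exact: gcomp0].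
have Xneq i j : (i < j <= m)%N -> M (X i - X j) /\ X i - X j != 0.
  move=> /andP[ij jm]; split; first by apply: subspaceB => //; exact: (MX _).1.
  rewrite subr_eq0 nth_uniq ?ltn_eqF //; last exact: leq_ltn_trans mxs.
  by apply: leq_ltn_trans mxs; apply: leq_trans (ltnW ij) jm.
(* The first difference also starts the product, in the role of [y_0]; this is where [m > 0]
   enters. *)
have [Mz z0] := Xneq 0%N 1%N m0.
have hz : gcomp B g (X 0%N - X 1%N).
  by apply: subspaceB (subspace_gcomp B g) _ _; exact: (MX _).2.
have XB i : gcomp B g (X i) by exact: (MX i).2.
have Xp : {in pairs m, forall p, M (X p.1 - X p.2) /\ X p.1 - X p.2 != 0}.
  by move=> [i j]; rewrite mem_pairs; apply: Xneq.
have [ys [es [sys ses hys]]] := dprod_neq0 XB Xp Mz (ex_intro _ g hz) z0.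
pose ys' := (X 0%N - X 1%N) :: ys; pose es' := g :: es.
have hys' k : gcomp B (nth 1%g es' k) (nth 0 ys' k) by case: k.
(* In [dpoly] even indices carry the [x_i] and odd ones the [y_k], so one valuation prescribes both
   even when degrees coincide. *)
pose v (q : gvar G) : B := if odd q.2
  then if q.1 == nth 1%g es' q.2./2 then nth 0 ys' q.2./2 else 0
  else if q.1 == g then X q.2./2 else 0.
have gv : graded_val v.
  move=> [h k]; rewrite /v /=; case: (odd k); case: eqP => [->|_] //;
    by [exact: gcomp0 | exact: (MX _).2].
have ses' : size es' == (size (pairs m)).+1 by rewrite /= ses.
have /eqP := Bm _ (imageP (fun q : G * _.-tuple G => dpoly m q.1 q.2)
  (Logic.I : setT (g, Tuple ses'))) v gv.
rewrite eval_dpoly /= => e; apply/negP; rewrite negbK; move: e.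
congr (_ == _); congr dprod.
- by apply/funext => i; rewrite /v /= odd_double eqxx doubleK.
- by rewrite /v /= eqxx.
congr zip; apply: (@eq_from_nth _ 0); first by rewrite size_mkseq sys.
move=> k; rewrite size_mkseq => kl; rewrite nth_mkseq // /v /=.
by rewrite odd_double /= uphalf_double eqxx.
Qed.

End Prime.
End Discriminator.

(** * Local finiteness *)

(** A duplicate-free list in [P] of maximal length exhausts [P]. *)
Lemma bounded_enum (T : eqType) (P : set T) m :
  (forall xs : seq T, uniq xs -> {in xs, forall x, P x} -> (size xs <= m)%N) ->
  exists xs : seq T, [/\ (size xs <= m)%N, {in xs, forall x, P x} &
    forall x, P x -> x \in xs].
Proof.
move=> bP; pose R n := `[< exists xs : seq T, [/\ uniq xs, {in xs, forall x,
  P x} & size xs = n] >].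
have R0 : exists n, R n by exists 0%N; apply/asboolP; exists [::].
have Rm n : R n -> (n <= m)%N by move=> /asboolP[xs [uxs Pxs <-]]; apply: bP.
have [n /asboolP[xs [uxs Pxs sxs]] maxn] := ex_maxnP R0 Rm.
exists xs; split=> //; first exact: bP.
move=> x Px; apply: contraT => xxs; have := maxn n.+1; rewrite ltnn; apply.
apply/asboolP; exists (x :: xs); split=> //=; [by rewrite xxs | | by rewrite sxs].
by move=> y; rewrite inE => /orP[/eqP->//|/Pxs].
Qed.

Section FiniteIndex.
Variables (F : fieldType) (G : finGroupType) (B : gradedAlg F G).
Implicit Types (I J K L N : set B) (x y : B).

(** Finite index; [W] is a possibly redundant list of coset representatives. *)
Definition fidx I := exists W : seq B, forall x, exists2 w, w \in W & I (x - w).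

Lemma fidx_cap I J : subspace I -> subspace J -> fidx I -> fidx J ->
  fidx (I `&` J).
Proof.
move=> sI sJ [W hW] [W' hW'].
(* [r] picks a common point of the cosets of [p.1] and [p.2], and 0 if they do not meet. *)
pose r (p : B * B) : B := if pselect (exists x,
  I (x - p.1) /\ J (x - p.2)) is left h
  then projT1 (cid h) else 0.
exists [seq r (w, w') | w <- W, w' <- W'] => x.
have [w Ww Iw] := hW x; have [w' Ww' Jw'] := hW' x.
exists (r (w, w')); first by apply/allpairsP; exists (w, w').
rewrite /r; case: pselect => [h|[]]; last by exists x.
case: cid => y /= [Iy Jy]; split.
  have -> : x - y = (x - w) - (y - w) by rewrite opprB addrA subrK.
  exact: subspaceB.
have -> : x - y = (x - w') - (y - w') by rewrite opprB addrA subrK.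
exact: subspaceB.
Qed.

Lemma fidx_finite I (s : seq B) : fidx I -> (forall x, I x -> x \in s) ->
  exists n, fcard B n.
Proof.
move=> [W hW] Is; exists (size [seq w + x | w <- W, x <- s]).
exists [seq w + x | w <- W, x <- s] => // x; have [w Ww Iw] := hW x.
by apply/allpairsP; exists (w, x - w); rewrite /= Ww Is // addrC subrK.
Qed.

Lemma graded_ideal0 : graded_ideal [set (0 : B)].
Proof.
apply/graded_idealP; split; first split.
- by apply/subspaceP; split=> // c _ _ -> ->; rewrite /= scaler0 addr0.
- by move=> a _ ->; rewrite gmul0l gmul0r.
- by move=> _ g ->; exact: gproj0.
Qed.

Lemma graded_idealT : graded_ideal [set: B].
Proof.
by apply/graded_idealP; split=> //; split=> //; apply/subspaceP.
Qed.

Lemma ideal_lann (L : set B) : (forall a x, L x -> L (gmul a x)) ->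
  ideal [set x | forall y, L y -> gmul x y = 0].
Proof.
move=> mL; split.
  apply/subspaceP; split=> [y _|c u v hu hv y Ly]; first exact: gmul0l.
  by rewrite gmul_linearl hu // hv // scaler0 addr0.
move=> a x hx; split=> y Ly; last by rewrite -gmulA hx //; apply: mL.
by rewrite -gmulA hx // gmul0r.
Qed.

Lemma gmul3_hom a b :
  (forall y, homog y -> gmul (gmul a y) b = 0) -> forall y, gmul (gmul a y) b = 0.
Proof.
move=> h y; rewrite [y]gproj_sum gmul_sumr gmul_suml big1 // => g _.
by apply: h; exists g; apply: gprojP.
Qed.

(** Annihilators replace the ideals generated by [a] and [b], and cores make them graded. The middle
    factor [q] is what makes [I1] two-sided. *)
Lemma annihilating_ideals a b : homog a -> homog b ->
    (forall y, homog y -> gmul (gmul a y) b = 0) ->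
  exists K1 K2, [/\ graded_ideal K1, graded_ideal K2, K1 a, K2 b
    & forall x q y, K1 x -> K2 y -> gmul (gmul x q) y = 0].
Proof.
move=> ha hb /gmul3_hom hab.
pose I1 := [set x | forall q, gmul (gmul x q) b = 0].
have iI1 : ideal I1.
  split.
    apply/subspaceP; split=> [q|c u v hu hv q]; first by rewrite !gmul0l.
    by rewrite !gmul_linearl hu hv scaler0 addr0.
  move=> c x hx; split=> q; last by rewrite -[gmul (gmul x c) q]gmulA hx.
  by rewrite -!gmulA [gmul x _]gmulA hx gmul0r.
pose I2 := [set y | forall x q, core I1 x -> gmul (gmul x q) y = 0].
have iI2 : ideal I2.
  split.
    apply/subspaceP; split=> [x q _|c u v hu hv x q Kx]; first exact: gmul0r.
    by rewrite gmul_linearr hu // hv // scaler0 addr0.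
  move=> c y hy; split=> x q Kx; last by rewrite gmulA hy // gmul0l.
  by rewrite gmulA -[gmul (gmul x q) c]gmulA hy.
exists (core I1), (core I2); split; do ?exact: core_graded.
- by apply: core_hom => //; case: iI1.
- by apply: core_hom => //; [case: iI2 | move=> x q /core_sub; apply; case: iI1].
- by move=> x q y Kx /core_sub; apply => //; case: iI2.
Qed.

Definition semiprime := forall N, graded_ideal N ->
  (forall x y, N x -> N y -> gmul x y = 0) -> forall x, N x -> x = 0.

Hypothesis spB : semiprime.

(** The part [N] of [L] that annihilates [L] has square zero, hence is zero. Products of homogeneous
    elements of [L] fall into [N], so [L] has square zero, and then its homogeneous elements fall
    into [N] too. *)
Lemma semiprime_cube L : graded_ideal L ->
  (forall x q y, L x -> L y -> gmul (gmul x q) y = 0) -> forall x, L x -> x = 0.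
Proof.
move=> hL L3; have [iL pL] := (graded_idealP _).1 hL; have [sL mL] := iL.
pose I1 := [set x | forall y, L y -> gmul x y = 0].
have iI1 : ideal I1 by apply: ideal_lann => a x Lx; exact: (mL a x Lx).1.
have hN := graded_idealI hL (core_graded iI1).
have N0 x : L x -> homog x -> I1 x -> x = 0.
  move=> Lx hx I1x; apply: (spB hN); last by split=> //;
    apply: core_hom iI1.1 hx I1x.
  by move=> u v [_ /(core_sub iI1.1) h] [Lv _]; apply: h.
have hom0 x y : L x -> L y -> homog x -> homog y -> gmul x y = 0.
  move=> Lx Ly [g gx] [h hy]; apply: N0; first exact: (mL x y Ly).1.
    by exists (g * h)%g; apply: gcompM.
  by move=> z Lz; apply: L3.
move=> x Lx; rewrite [x]gproj_sum big1 // => g _; apply: N0; first exact: pL.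
  by exists g; apply: gprojP.
move=> y Ly; rewrite [y]gproj_sum gmul_sumr big1 // => k _.
by apply: hom0; [exact: pL | exact: pL | exists g; apply: gprojP | exists k;
  apply: gprojP].
Qed.

Lemma semiprime_hom x : homog x ->
  (forall y, homog y -> gmul (gmul x y) x = 0) -> x = 0.
Proof.
move=> hx h; have [K1 [K2 [h1 h2 x1 x2 h12]]] := annihilating_ideals hx hx h.
apply: (semiprime_cube (graded_idealI h1 h2)) => // u q v [] Ku _ [] _ Kv.
exact: h12.
Qed.

End FiniteIndex.

Section FiniteField.
Variables (F : finFieldType) (G : finGroupType) (B : gradedAlg F G).
Implicit Types (I J K L N : set B) (x y : B).

(** The linear span of [Z] as an explicit list, available because [F] is finite. *)
Fixpoint sumset (Z : seq B) : seq B :=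
  if Z is z :: Z' then [seq c *: z + x | c <- enum F, x <- sumset Z'] else [:: 0].

Lemma sumset_subspace (Z : seq B) : subspace [set` sumset Z].
Proof.
elim: Z => [|z Z /subspaceP[s0 sL]]; apply/subspaceP; split=> /=.
- by rewrite inE.
- by move=> c u v; rewrite !inE => /eqP-> /eqP->; rewrite scaler0 addr0.
- by apply/allpairsP; exists (0, 0); rewrite mem_enum s0 scale0r addr0.
move=> c _ _ /allpairsP[[a x] /= [_ xZ ->]] /allpairsP[[b y] /= [_ yZ ->]].
apply/allpairsP; exists (c * a + b, c *: x + y); rewrite mem_enum; split=> //.
  exact: sL.
by rewrite /= scalerDr scalerDl scalerA addrACA.
Qed.

Lemma sub_sumset (Z : seq B) : {subset Z <= sumset Z}.
Proof.
elim: Z => //= z Z IH x; rewrite inE => /orP[/eqP->|/IH xZ]; apply/allpairsP.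
  exists (1, 0); rewrite mem_enum scale1r addr0; split=> //.
  by have /subspace0 := sumset_subspace Z.
by exists (0, x); rewrite mem_enum scale0r add0r.
Qed.

Lemma span_sumset (Z : seq B) x : span [set` Z] x -> x \in sumset Z.
Proof.
move: x; apply: (span_sub (W := [set` sumset Z]) (sumset_subspace Z)) => x.
exact: sub_sumset.
Qed.

Lemma hom_enum_finite m :
  (forall g (xs : seq B), uniq xs -> {in xs, forall x, gcomp B g x} ->
    (size xs <= m)%N) ->
  exists n, fcard B n.
Proof.
move=> bB; have /choice[e he] g : exists xs : seq B, forall x, gcomp B g x ->
  x \in xs.
  by have [xs []] := bounded_enum (bB g); exists xs.
exists (size (sumset (flatten [seq e g | g <- enum G]))).
exists (sumset (flatten [seq e g | g <- enum G])) => // x; apply: span_sumset.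
rewrite [x]gproj_sum; apply: subspace_sumP (span_subspace _) _ => g _.
apply: sub_span; apply/flattenP; exists (e g); last exact/he/gprojP.
by apply/mapP; exists g => //; rewrite mem_enum.
Qed.

(* An ideal of finite index in a finitely generated algebra is finitely
   generated up to finite index. *)
Lemma fidx_fin_gen (S : set B) I : finite_set S -> gen S = setT -> fidx I ->
  exists2 Y : seq B, {in Y, forall y, I y} &
    forall J, ideal J -> {in Y, forall y, J y} -> fidx J.
Proof.
move=> /finite_seqP[s ->] genS [W hW].
have /choice[r hr] x : exists w, w \in W /\ I (x - w).
  by have [w] := hW x; exists w.
(* [Z] lists the results of one operation on representatives, together with 0 and the generators. If
   [J] contains all corrections [z - r z], then [W] is closed under these operations modulo [J]. *)
pose Z := [seq gmul w a | w <- W, a <- s] ++ [seq w + w' | w <- W, w' <- W] ++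
  [seq c *: w | c <- enum F, w <- W] ++ 0 :: s.
exists [seq z - r z | z <- Z] => [_ /mapP[z _ ->]|J [sJ mJ] YJ];
  first exact: (hr z).2.
have JZ z : z \in Z -> J (z - r z) by move=> zZ; apply/YJ/map_f.
(* [D] is [W + J] and [E] its set of right multipliers; [D] intersected with [E] is a subalgebra
   containing the generators, hence everything. *)
exists W; pose D := [set x | exists2 w, w \in W & J (x - w)].
pose E := [set a | forall x, D x -> D (gmul x a)].
have rD x y : J (x - y) -> y \in Z -> D x.
  move=> Jxy /JZ Jy; exists (r y); first exact: (hr y).1.
  by rewrite -[x](subrK y) -addrA; apply: subspaceD.
have sD : subspace D.
  have D0 : D 0.
    by apply: (rD _ 0); [rewrite subrr;
      apply: subspace0 | rewrite !mem_cat mem_head !orbT].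
  have DD x y : D x -> D y -> D (x + y).
    move=> [w Ww Jw] [w' Ww' Jw']; apply: (rD _ (w + w')).
      by rewrite opprD addrACA; apply: subspaceD.
    by rewrite !mem_cat (allpairs_f _ Ww Ww') orbT.
  have DZ c x : D x -> D (c *: x).
    move=> [w Ww Jw]; apply: (rD _ (c *: w)).
      by rewrite -scalerBr; apply: subspaceZ sJ _.
    by rewrite !mem_cat (allpairs_f _ _ Ww) ?orbT ?mem_enum.
  by apply/subspaceP; split=> // c u v Du Dv; apply: DD => //; apply: DZ.
have sDE : subalgebra (D `&` E).
  split; last first.
    move=> a b [Da Ea] [Db Eb]; split; first exact: Eb.
    by move=> x Dx; rewrite gmulA; apply/Eb/Ea.
  apply: subspaceI => //; apply/subspaceP; split=> [x _|c u v Eu Ev x Dx].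
    by rewrite gmul0r; apply: subspace0.
  by rewrite gmul_linearr; apply: subspaceL => //; [apply: Eu | apply: Ev].
move=> x; suff [] : (D `&` E) x by [].
have : gen [set` s] x by rewrite genS.
apply: gen_min sDE _ x => a /= sa; split.
  apply: (rD _ a); first by rewrite subrr; apply: subspace0.
  by rewrite !mem_cat inE sa !orbT.
move=> x [w Ww Jw]; apply: (rD _ (gmul w a)).
  by rewrite -gmulBl; exact: (mJ a _ Jw).2.
by rewrite mem_cat allpairs_f.
Qed.

End FiniteField.

Section JustInfinite.
Variables (F : finFieldType) (G : finGroupType) (Q : gradedAlg F G).
Variables (S : set Q) (m : nat).
Hypotheses (finS : finite_set S) (genS : gen S = setT).
Hypothesis fidxQ :
  forall K : set Q, graded_ideal K -> forall x, K x -> x != 0 -> fidx K.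
Hypotheses (m0 : (0 < m)%N) (Qm : variety_of (dset m) Q).

(* A nonzero square-zero ideal [N] of finite index contains a finitely
   generated ideal of finite index, which is a bimodule over the finite algebra
   [Q / N], hence finite. *)
Lemma just_infinite_semiprime : (forall n, ~ fcard Q n) -> semiprime Q.
Proof.
move=> infQ N hN N2 x Nx; apply/eqP; apply: contraT => x0.
have [W hW] := fidxQ hN Nx x0.
have [Y YN hY] := fidx_fin_gen finS genS (fidxQ hN Nx x0).
have [[sN mN] _] := (graded_idealP _).1 hN.
have /choice[r hr] q : exists w, w \in W /\ N (q - w).
  by have [w] := hW q; exists w.
have rR u q : N u -> gmul u q = gmul u (r q).
  move=> Nu; apply/eqP; rewrite -subr_eq0 -gmulBr N2 //; exact: (hr q).2.
have rL u q : N u -> gmul q u = gmul (r q) u.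
  move=> Nu; apply/eqP; rewrite -subr_eq0 -gmulBl N2 //; exact: (hr q).2.
have rW q : r q \in W by exact: (hr q).1.
(* These are all [y], [y q], [q y] and [q y q']: as [N] has square zero, multiplying an element of
   [N] by [q] depends only on the coset of [q], so representatives suffice. The span of [Z] is the
   ideal generated by [Y]. *)
pose Z := Y ++ [seq gmul y w | y <- Y, w <- W] ++ [seq gmul w y | w <- W, y <- Y]
  ++ [seq gmul u w' | u <- [seq gmul w y | w <- W, y <- Y], w' <- W].
have Zy y : y \in Y -> y \in Z by rewrite mem_cat => ->.
have Zyw y q : y \in Y -> gmul y q \in Z.
  by move=> Yy; rewrite (rR _ _ (YN y Yy)) !mem_cat (allpairs_f _ Yy (rW q))
    !orbT.
have Zwy y q : y \in Y -> gmul q y \in Z.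
  by move=> Yy; rewrite (rL _ _ (YN y Yy)) !mem_cat (allpairs_f _ (rW q) Yy)
    !orbT.
have Zwyw y q q' : y \in Y -> gmul (gmul q y) q' \in Z.
  move=> Yy; have Ny := YN y Yy; rewrite (rL _ _ Ny) (rR _ q');
    last exact: (mN _ _ _).1.
  by rewrite !mem_cat (allpairs_f (fun u w => gmul u w) (allpairs_f _ (rW q)
    Yy) (rW q')) !orbT.
pose D := span [set` Z].
have sD : subspace D by exact: span_subspace.
have ZD z : z \in Z -> D z by move=> zZ; apply: sub_span.
have iD : ideal D.
  split=> // a; have idl : linear (gmul a) by exact: gmul_linearr.
  have idr : linear (gmul^~ a) by exact: gmul_linearl.
  suff DZ : [set` Z] `<=` (gmul a @^-1` D) `&` (gmul^~ a @^-1` D).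
    move=> u Du; have : ((gmul a @^-1` D) `&` (gmul^~ a @^-1` D)) u.
      by apply: span_sub DZ _ Du; apply: subspaceI; apply: subspace_preim.
    by case.
  move=> z; rewrite /= !mem_cat => /or4P[Yz|/allpairsP[[y w] /= [Yy _ ->]]
    |/allpairsP[[w y] /= [_ Yy ->]]
    |/allpairsP[[u w'] /= [/allpairsP[[w y] /= [_ Yy ->]] _ ->]]].
  - by split; apply: ZD; [apply: Zwy | apply: Zyw].
  - by split; rewrite /preimage /mkset ?gmulA; [| rewrite -gmulA]; apply: ZD;
    [apply: Zwyw | apply: Zyw].
  - by split; rewrite /preimage /mkset ?gmulA; apply: ZD;
    [apply: Zwy | apply: Zwyw].
  - split; rewrite /preimage /mkset; apply: ZD.
      by rewrite gmulA [gmul a _]gmulA; apply: Zwyw.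
    by rewrite -gmulA; apply: Zwyw.
have [|n Qn] := @fidx_finite _ _ _ D (sumset Z) _ (span_sumset (Z := Z)).
  by apply: hY => // y /Zy/ZD.
by case: (infQ n).
Qed.

(** If [a Q b = 0] with [a] and [b] nonzero, the ideals [K1] and [K2] have finite index, and so does
    their intersection; but the latter is zero by [semiprime_cube], so [Q] is finite. Otherwise [Q]
    is prime and the discriminator identities bound every component. *)
Lemma just_infinite_finite : exists n, fcard Q n.
Proof.
apply: contrapT => /forallNP infQ.
have spQ := just_infinite_semiprime infQ.
apply: (infQ 0%N).
have primQ (a b : Q) : setT a -> setT b -> homog a -> homog b -> a != 0 ->
  b != 0 ->
    exists2 y, homog y & gmul (gmul a y) b != 0.
  move=> _ _ ha hb a0 b0; apply: contrapT => nab.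
  have [y hy|K1 [K2 [h1 h2 K1a K2b h12]]] := @annihilating_ideals _ _ _ a b ha hb.
    by apply/eqP; apply: contraT => ny; case: nab; exists y.
  have K0 := semiprime_cube spQ (graded_idealI h1 h2) (fun u q v hu hv => h12 u
    q v hu.1 hv.2).
  have sK K : graded_ideal K -> subspace K by case=> -[].
  have [||n Qn] := @fidx_finite _ _ _ (K1 `&` K2) [:: 0] _ _;
    last exact: (infQ n).
    by apply: fidx_cap; [exact: sK | exact: sK | exact: fidxQ K1a a0 |
      exact: fidxQ K2b b0].
  by move=> u Ku; rewrite inE (K0 u Ku).
have [|n Qn] := @hom_enum_finite _ _ Q m; last by case: (infQ n).
move=> g xs uxs gxs; have h := prime_bound (g :=
  g) (graded_idealT Q) primQ m0 Qm uxs.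
by apply: h => x /gxs.
Qed.

End JustInfinite.

Section LocallyFinite.
Variables (F : finFieldType) (G : finGroupType) (m : nat).
Hypothesis m0 : (0 < m)%N.

Lemma preim_graded_ideal (A : gradedAlg F G) (I : set A) (hI : graded_ideal I)
    (K : set (quot hI)) :
  graded_ideal K -> graded_ideal (quot_pi hI @^-1` K).
Proof.
move=> /graded_idealP[[sK mK] pK].
have pil : linear (quot_pi hI : A -> quot hI) by exact: quot_piL.
apply/graded_idealP; split; first split; first exact: (subspace_preim pil sK).
  move=> a x Kx; rewrite /preimage /mkset.
  by rewrite !(quot_piM hI); split; [exact: (mK _ _ Kx).1 | exact: (mK _ _ Kx).2].
move=> x g Kx; rewrite /preimage /mkset -(hom_gproj pil); first exact: pK.
by move=> h a ha; exists a.
Qed.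

Lemma quot_gen (A : gradedAlg F G) (I : set A) (hI : graded_ideal I) (S : set A) :
  gen S = setT -> gen (A := quot hI) (quot_pi hI @` S) = setT.
Proof.
move=> genS; apply/seteqP; split=> // q _; have [x ->] := quot_pi_surj q.
have [sg mg] := gen_subalgebra (A := quot hI) (quot_pi hI @` S).
suff : gen S `<=` quot_pi hI @^-1` (gen (A := quot hI) (quot_pi hI @` S)).
  by apply; rewrite genS.
apply: gen_min => [|y Sy]; last by apply: (sub_gen (A := quot hI)); exists y.
split; first by apply: (subspace_preim (B := quot hI)) => //; exact: quot_piL.
by move=> a b ga gb; rewrite /preimage /mkset (quot_piM hI); apply: mg.
Qed.

(** Zorn applies because of [fidx_fin_gen]: if the union of a chain had finite index, finitely many
    of its elements, hence one member of the chain, would already force finite index. *)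
Lemma max_infinite_index (A : gradedAlg F G) (S : set A) :
    finite_set S -> gen S = setT -> ~ finite_set [set: A] ->
  exists2 I : set A, graded_ideal I & ~ fidx I /\
    forall K : set A, graded_ideal K -> I `<` K -> fidx K.
Proof.
move=> finS genS infA.
pose P : set (set A) := [set I | I = set0 \/ graded_ideal I /\ ~ fidx I].
have P0 : P [set 0].
  right; split; first exact: graded_ideal0.
  move=> h0; have [x ->|n] := @fidx_finite _ _ _ _ [:: 0] h0.
    by rewrite inE.
  by move/fcard_finite.
have [C CP totC|I [[I0|[hI nI]] maxI]] := @Zorn_bigcup _ P; last 2 first.
- by case: (maxI [set 0]) => //; rewrite I0; split=> [x []|/(_ 0 erefl) []].
- exists I => //; split=> // K hK IK; apply: contrapT => nK.
  by apply: (maxI K) => //; right.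
have [[I0 CI0 /set0P I00]|nC] := pselect (exists2 I0, C I0 & I0 != set0);
  last first.
  left; apply/seteqP; split=> // x [I CI Ix]; case: nC; exists I => //.
  by apply/set0P; exists x.
right; set U := \bigcup_(X in C) X.
have grI I x : C I -> I x -> graded_ideal I /\ ~ fidx I.
  by move=> CI Ix; case: (CP I CI) => // I0'; rewrite I0' in Ix.
have U0 : U 0.
  have [x I0x] := I00; exists I0 => //.
  by have [/graded_ideal_ideal[sI _] _] := grI _ _ CI0 I0x; apply: subspace0.
have hU : graded_ideal U.
  apply/graded_idealP; split; first split.
  - apply/subspaceP; split=> // c u v [I CI Iu] [J CJ Jv].
    have [IJ|JI] := totC I J CI CJ.
      have [/graded_ideal_ideal[sJ _] _] := grI _ _ CJ Jv.
      by exists J => //; apply: subspaceL => //; apply: IJ.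
    have [/graded_ideal_ideal[sI _] _] := grI _ _ CI Iu.
    by exists I => //; apply: subspaceL => //; apply: JI.
  - move=> a x [I CI Ix]; have [[_ /(_ a x Ix)[Il Ir]] _] := grI _ _ CI Ix.
    by split; exists I.
  - move=> x g [I CI Ix]; exists I => //; have [hI _] := grI _ _ CI Ix.
    exact: graded_ideal_proj.
split=> // fU; have [Y YU hY] := fidx_fin_gen finS genS fU.
have [I CI [[x Ix] YI]] : exists2 I, C I & I !=set0 /\ {in Y, forall y, I y}.
  elim: Y YU {hY} => [|y Y IH] YU; first by exists I0.
  have [z zY|I CI [In YI]] := IH; first by apply: YU; rewrite inE zY orbT.
  have [J CJ Jy] := YU y (mem_head _ _).
  have [IJ|JI] := totC I J CI CJ; [exists J => // | exists I => //]; split=> //.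
  - by exists y.
  - by move=> z; rewrite inE => /orP[/eqP->//|/YI/IJ].
  - by move=> z; rewrite inE => /orP[/eqP->|/YI//]; apply: JI.
have [hI nI] := grI _ _ CI Ix; apply: nI; apply: hY => //.
exact: graded_ideal_ideal.
Qed.

Lemma dset_locally_finite : locally_finite (@variety_of F G (dset m)).
Proof.
move=> A Am [S [finS genS]]; apply: contrapT => infA.
have [I hI [nI maxI]] := max_infinite_index finS genS infA.
have [|K hK x Kx x0||n] :=
    @just_infinite_finite F G (quot hI) (quot_pi hI @` S) m _ (quot_gen hI
      genS) _ m0 _.
- exact: finite_image.
- have [|W hW] := maxI _ (preim_graded_ideal hK).
    have [y ey] := quot_pi_surj x; split=> [z Iz|/(_ y)].
      by rewrite /preimage /mkset (quot_pi_eq0 hI z).2 //;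
        case: hK => [[/subspace0]].
    rewrite /preimage /mkset -ey => /(_ Kx)/(quot_pi_eq0 hI) y0.
    by rewrite ey y0 eqxx in x0.
  exists [seq (quot_pi hI w : quot hI) | w <- W] => q;
    have [z ->] := quot_pi_surj q.
  have [w Ww Kw] := hW z; exists (quot_pi hI w); first exact: map_f.
  by move: Kw; rewrite /preimage /mkset (linB (quot_piL hI)).
- exact: variety_quot.
move=> [s _ sQ]; apply: nI; exists [seq repr q | q <- s] => x.
exists (repr (quot_pi hI x)); first exact: map_f.
by apply/(quot_piP hI)/esym/(quot_piP hI); apply: quot_repr.
Qed.

End LocallyFinite.

(** * Idempotents and nilpotency *)

Section Products.
Variables (F : fieldType) (G : finGroupType) (B : gradedAlg F G).
Implicit Types (a b x y e : B) (s u : seq B) (J N : set B).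

(** For want of a unit, a product is stored as a list together with its last factor. *)
Definition mulw s x : B := foldr gmul x s.

Lemma mulw_cat s u x : mulw (s ++ u) x = mulw s (mulw u x).
Proof. by rewrite /mulw foldr_cat. Qed.

Lemma mulw0 s : mulw s 0 = 0.
Proof. by elim: s => //= a s ->; rewrite gmul0r. Qed.

Lemma mulwM s x y : mulw s (gmul x y) = gmul (mulw s x) y.
Proof. by elim: s => //= a s ->; rewrite gmulA. Qed.

Lemma mulw_rcons s a x : mulw (rcons s a) x = gmul (mulw s a) x.
Proof. by rewrite -cats1 mulw_cat mulwM. Qed.

Lemma mulw_in (D : set B) s x : (forall a b, D a -> D b -> D (gmul a b)) ->
  {in s, forall a, D a} -> D x -> D (mulw s x).
Proof.
move=> mD; elim: s => //= a s IH Ds Dx; apply: mD; first by apply/Ds/mem_head.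
by apply: IH => // b bs; apply: Ds; rewrite inE bs orbT.
Qed.

Lemma homogM x y : homog x -> homog y -> homog (gmul x y).
Proof. by move=> [g gx] [h hy]; exists (g * h)%g; apply: gcompM. Qed.

(** This is the power of [a] with exponent [k + 1]. *)
Definition pw a k := iter k (gmul a) a.

Lemma pwD a k l : gmul (pw a k) (pw a l) = pw a (k + l).+1.
Proof. by elim: k => //= k IH; rewrite -gmulA IH. Qed.

Lemma pw_in (D : set B) a k : (forall a b, D a -> D b -> D (gmul a b)) ->
  D a -> D (pw a k).
Proof. by move=> mD Da; elim: k => //= k IH; apply: mD. Qed.

Lemma pw_gcomp1 a k : gcomp B 1%g a -> gcomp B 1%g (pw a k).
Proof. by move=> a1; apply: pw_in => // x y x1 /(gcompM x1); rewrite mulg1. Qed.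

Lemma pw_idem e k : gmul e e = e -> pw e k = e.
Proof. by move=> ee; elim: k => //= k ->. Qed.

Lemma idempotent_power (D : seq B) a : (forall k, pw a k \in D) ->
  exists k, gmul (pw a k) (pw a k) = pw a k.
Proof.
move=> Da; have : ~~ uniq (mkseq (pw a) (size D).+1).
  apply/negP => us; suff : (size (mkseq (pw a) (size D).+1) <= size D)%N.
    by rewrite size_mkseq ltnn.
  by apply: uniq_leq_size => // _ /mapP[k _ ->].
move=> /(uniqPn 0)[i [j []]]; rewrite size_mkseq => ij jn.
rewrite !nth_mkseq // ?(ltn_trans ij) // => eij.
set d := (j - i)%N; have d0 : (0 < d)%N by rewrite subn_gt0.
have per k : (i <= k)%N -> pw a (k + d) = pw a k.
  move=> /subnK <-; rewrite -addnA subnKC ?(ltnW ij) //.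
  by elim: (k - i)%N => [|l IH]; rewrite ?add0n // !addSn /= IH.
have perc c k : (i <= k)%N -> pw a (k + c * d) = pw a k.
  move=> ik; elim: c => [|c IH]; first by rewrite addn0.
  by rewrite mulSn [(d + _)%N]addnC addnA per // (leq_trans ik) // leq_addr.
have id0 : (0 < i.+1 * d)%N by rewrite muln_gt0.
(* The exponent [(i + 1) d] is a multiple of the period [d] and lies beyond the preperiod, so
   doubling it changes nothing. *)
exists (i.+1 * d).-1; rewrite pwD -addnS prednK // perc //.
by rewrite -ltnS prednK // leq_pmulr.
Qed.

(* A principal idempotent: [e] is chosen so that [x |-> e x] has as many fixed
   points as possible. *)
Lemma principal_idempotent (D : seq B) N : subspace N ->
    (forall a b, N a -> N b -> N (gmul a b)) -> (forall x, N x -> x \in D) ->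
  exists e, [/\ N e, gcomp B 1%g e, gmul e e = e &
    forall f, N f -> gcomp B 1%g f -> gmul f f = f -> gmul e f = 0 ->
      gmul f e = 0 -> f = 0].
Proof.
move=> sN mN ND; pose fx e := [seq x <- undup D | gmul e x == x].
pose R n := `[< exists e, [/\ N e, gcomp B 1%g e, gmul e e = e &
  size (fx e) = n] >].
have R0 : exists n, R n.
  exists (size (fx 0)); apply/asboolP; exists 0.
  by split; [exact: subspace0 | exact: gcomp0 | exact: gmul0l |].
have RD n : R n -> (n <= size (undup D))%N.
  by move=> /asboolP[e [_ _ _ <-]]; rewrite size_filter count_size.
have [_ /asboolP[e [Ne e1 ee <-]] maxe] := ex_maxnP R0 RD.
exists e; split=> // f Nf f1 ff ef fe; apply/eqP; apply: contraT => f0.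
(* [e + f] is an idempotent that fixes [f] in addition to everything fixed by [e]. *)
suff : (size (fx e) < size (fx (e + f)%R))%N.
  rewrite ltnNge => /negP[]; apply: maxe; apply/asboolP; exists (e + f).
  split=> //; [exact: subspaceD | exact: subspaceD (subspace_gcomp _ _) _ _ |].
  by rewrite gmulDl !gmulDr ee ef fe ff addr0 add0r.
have fD : f \in undup D by rewrite mem_undup ND.
have nf : f \notin fx e by rewrite mem_filter ef eq_sym (negbTE f0).
apply: (@uniq_leq_size _ (f :: fx e));
  first by rewrite /= nf filter_uniq ?undup_uniq.
move=> x; rewrite inE => /orP[/eqP->|].
  by rewrite mem_filter gmulDl ef ff add0r eqxx.
rewrite !mem_filter => /andP[/eqP ex ->]; rewrite andbT gmulDl ex.
by rewrite -[in gmul f x]ex gmulA fe gmul0l addr0.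
Qed.

(** Two of the [n + 1] values of suffixes coincide, so a segment [c] of the word fixes the value of
    a suffix. If that value is nonzero, homogeneity forces [c] into degree 1; then [c] is nilpotent
    and the value is zero after all. *)
Lemma nil_pigeonhole n s x : fcard B n -> (n <= size s)%N ->
    {in s, forall a, homog a} -> homog x ->
    (forall a u, {subset a :: u <= s} ->
      gcomp B 1%g (mulw (belast a u) (last a u)) ->
       exists k, pw (mulw (belast a u) (last a u)) k = 0) ->
  mulw s x = 0.
Proof.
move=> Bn ns hs hx nil.
have [i [j [/andP[ij jn] eij]]] :=
  fcard_pigeonhole (fun i => mulw (drop i s) x) Bn.
have is_ : (i < size s)%N by apply: leq_trans ij (leq_trans jn ns).
rewrite -(cat_take_drop i s) mulw_cat.
have [->|X0] := eqVneq (mulw (drop i s) x) 0; first exact: mulw0.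
have hX : homog (mulw (drop j s) x).
  by apply: mulw_in hx => [|a /mem_drop]; [exact: homogM | exact: hs].
have : drop i s = drop i (take j s) ++ drop j s.
  by rewrite -{1}(cat_take_drop j s) drop_cat size_takel ?(leq_trans jn) // ij.
have us : {subset drop i (take j s) <= s} by move=> y /mem_drop /mem_take.
case eu : (drop i (take j s)) us => [|a u] us e.
  have := congr1 size eu;
    rewrite size_drop size_takel ?(leq_trans jn) //= => /eqP.
  by rewrite subn_eq0 leqNgt ij.
set c := mulw (belast a u) (last a u).
have eX : mulw (drop i s) x = gmul c (mulw (drop i s) x).
  by rewrite {1}e mulw_cat -eij lastI mulw_rcons.
have hc : homog c.
  apply: mulw_in; [exact: homogM | move=> y yu|]; apply/hs/us.
    exact: mem_belast.
  exact: mem_last.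
have c1 : gcomp B 1%g c.
  have [g gc] := hc; have [h hX'] := hX; rewrite -eij in hX'.
  have := gcomp_inj (gcompM gc hX'); rewrite -eX => /(_ h hX' X0) gh.
  by have -> : 1%g = g by apply: (mulIg h); rewrite mul1g gh.
have [k ck] := nil a u us c1.
rewrite (_ : mulw (drop i s) x = gmul (pw c k) (mulw (drop i s) x)).
  by rewrite ck gmul0l mulw0.
by elim: k {ck} => //= k IH; rewrite -gmulA -IH.
Qed.

(* The span [J^k B], with [J^0 B = B]. *)
Fixpoint Jp J k : set B :=
  if k is k'.+1 then span [set z | exists a y, [/\ J a, Jp J k' y & z = gmul a y]]
  else setT.

Lemma Jp_subspace J k : subspace (Jp J k).
Proof. by case: k => [|k]; [exact/subspaceP | exact: span_subspace]. Qed.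

Lemma JpS J k a y : J a -> Jp J k y -> Jp J k.+1 (gmul a y).
Proof. by move=> Ja Jy; apply: sub_span; exists a, y. Qed.

Lemma Jp_mull J k a y : ideal J -> Jp J k y -> Jp J k (gmul a y).
Proof.
move=> [sJ mJ]; case: k => // k; move: y.
suff h : [set z | exists a y, [/\ J a, Jp J k y & z = gmul a y]] `<=`
    gmul a @^-1` Jp J k.+1.
  apply: span_sub h; apply: subspace_preim (Jp_subspace J k.+1).
  exact: gmul_linearr.
move=> _ [b [y [Jb Jy ->]]]; rewrite /preimage /mkset gmulA.
by apply: JpS => //; exact: (mJ a b Jb).1.
Qed.

Lemma Jp_le J k l : ideal J -> (k <= l)%N -> Jp J l `<=` Jp J k.
Proof.
move=> iJ /subnK <-; elim: (l - k)%N => // j IH.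
rewrite addSn; apply: span_sub; first exact: Jp_subspace.
by move=> _ [a [y [Ja Jy ->]]]; apply: Jp_mull => //; apply: IH.
Qed.

(** Identities speak of homogeneous values only; this reduces [Jp] to words in such letters. *)
Lemma Jp_words J k : graded_ideal J ->
  Jp J k `<=` span [set z | exists s y, [/\ size s = k,
    {in s, forall a, J a /\ homog a} & z = mulw s y]].
Proof.
move=> hJ; elim: k => [|k IH].
  by move=> y _; apply: sub_span; exists [::], y.
set W := span _; have sW : subspace W by exact: span_subspace.
apply: span_sub => // _ [a [y [Ja Jy ->]]].
rewrite [a]gproj_sum gmul_suml; apply: subspace_sumP => // g _.
set b := gproj a g; have Jb : J b by exact: graded_ideal_proj.
have hb : homog b by exists g; apply: gprojP.
apply: span_sub (subspace_preim (gmul_linearr b) sW) _ _ (IH y Jy).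
move=> _ [s [z [ss Js ->]]]; apply: sub_span; exists (b :: s), z.
by split=> //=; [rewrite ss | move=> c; rewrite inE => /orP[/eqP->|/Js]].
Qed.

Lemma word_eval_Jp J (v : gvar G -> B) (w : seq (gvar G)) y :
  (forall x : gvar G, J (v x)) -> w != [::] ->
    Jp J (size w) (gmul (word_eval v w) y).
Proof.
move=> Jv; elim: w => // x [|z w] IH _; first by apply: (@JpS _ 0%N (v x) y).
rewrite -[x :: _]cat1s word_eval_cat // -gmulA; apply: JpS; first exact: Jv.
exact: IH.
Qed.

Lemma ford_Jp J (v : gvar G -> B) f k y : ideal J ->
  (forall x : gvar G, J (v x)) ->
  ford k f -> Jp J k (gmul (eval v f) y).
Proof.
move=> iJ Jv fk; rewrite /eval gmul_suml big_seq.
apply: subspace_sumP (Jp_subspace J k) _ => w wf.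
rewrite gmulZl; apply: subspaceZ (Jp_subspace J k) _.
apply: Jp_le iJ (fk w wf) _ _; apply: word_eval_Jp => //.
exact: supp_nonempty wf.
Qed.

End Products.

Section IdealUnit.
Variables (F : fieldType) (G : finGroupType) (Q : gradedAlg F G) (n : nat).
Hypotheses (spQ : semiprime Q) (Qn : fcard Q n).

(** Let [e] be a principal idempotent of [N]. A nonzero [s - e s] would start arbitrarily long
    nonzero products with factors in the corner [N']. Degree-1 elements of [N'] are nilpotent, since
    an idempotent power in [N'] is zero by the choice of [e], and [nil_pigeonhole] gives a
    contradiction. *)
Lemma ideal_unit (N : set Q) : graded_ideal N ->
  exists e, [/\ N e, gcomp Q 1%g e
    & forall s, N s -> gmul e s = s /\ gmul s e = s].
Proof.
move=> hN; have [[sN mN'] pN] := (graded_idealP N).1 hN.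
have Nl a x : N x -> N (gmul a x) by move=> /(mN' a)[].
have Nr a x : N x -> N (gmul x a) by move=> /(mN' a)[].
have [D _ QD] := Qn.
have [||e [Ne e1 ee pe]] := @principal_idempotent _ _ Q D N sN.
- by move=> a b _; apply: Nl.
- by move=> x _; apply: QD.
have he : homog e by exists 1%g.
pose N' := [set a | [/\ N a, gmul e a = 0 & gmul a e = 0]].
have mN'' a b : N' a -> N' b -> N' (gmul a b).
  by move=> [Na ea ae] [Nb eb be]; split;
    rewrite ?gmulA ?ea ?gmul0l // -?gmulA ?be ?gmul0r //; apply: Nl.
have homl a : homog a -> homog (a - gmul e a).
  move=> [g ga]; exists g; apply: subspaceB (subspace_gcomp Q g) _ _ => //.
  by rewrite -[g]mul1g; apply: gcompM.
have homr a : homog a -> homog (a - gmul a e).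
  move=> [g ga]; exists g; apply: subspaceB (subspace_gcomp Q g) _ _ => //.
  by rewrite -[g]mulg1; apply: gcompM.
have left_unit s : N s -> homog s -> s - gmul e s = 0.
  move=> Ns hs; apply/eqP; apply: contraT => x0; set x := s - _ in x0.
  have Nx : N x by apply: subspaceB => //; apply: Nl.
  have ex : gmul e x = 0 by rewrite /x gmulBr gmulA ee subrr.
  have chain k : exists us z, [/\ size us = k, {in us, forall u, N' u /\ homog u},
      homog z, mulw us z != 0 & N (mulw us z) /\ gmul e (mulw us z) = 0].
    elim: k => [|k [us [z [sus hus hz y0 [Ny ey]]]]].
      by exists [::], x; split=> //; apply: homl.
    set y := mulw us z in y0 Ny ey.
    have hy : homog y by apply: mulw_in hz => [|u /hus[]//]; exact: homogM.
    have [q hq yqy] : exists2 q, homog q & gmul (gmul y q) y != 0.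
      apply: contrapT => nq; move/eqP: y0; apply;
        apply: (semiprime_hom spQ) => // q hq.
      by apply/eqP; apply: contraT => yqy; case: nq; exists q.
    (* Subtracting [y q e] puts [u] in the corner, while [u y = y q y] stays nonzero because
       [e y = 0]. *)
    set u := gmul y q - gmul (gmul y q) e.
    have uy : gmul u y = gmul (gmul y q) y.
      by rewrite /u gmulBl -[gmul (gmul _ e) y]gmulA ey gmul0r subr0.
    have Nu : N u by apply: subspaceB => //;
      [exact: Nr | exact: (Nr _ _ (Nr _ _ Ny))].
    have eu : gmul e u = 0 by rewrite /u gmulBr !gmulA ey !gmul0l subrr.
    exists (u :: us), z; rewrite /= -/y uy; split=> //; first by rewrite sus.
      move=> w; rewrite inE => /orP[/eqP->|/hus//]; split.
        by split=> //; rewrite /u gmulBl -[gmul (gmul _ e) e]gmulA ee subrr.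
      by apply: homr; apply: homogM.
by split; [exact: Nl | rewrite !gmulA ey !gmul0l].
  have [us [z [sus hus hz y0 _]]] := chain n.
  move: y0; rewrite (nil_pigeonhole Qn) ?eqxx ?sus // => [u /hus[]//|a u us_ c1].
  set c := mulw _ _ in c1 *.
  have Nc : N' c.
    apply: mulw_in mN'' _ _ => [w wu|];
      first by have [] := hus w (us_ w (mem_belast wu)).
    by have [] := hus _ (us_ _ (mem_last a u)).
  have [k kk] := @idempotent_power _ _ Q D c (fun k => QD _).
  have [Np ep pe'] := pw_in k mN'' Nc.
  by exists k; apply: pe => //; apply: pw_gcomp1.
have lu s : N s -> gmul e s = s.
  move=> Ns; rewrite [s]gproj_sum gmul_sumr; apply: eq_bigr => g _.
  apply/esym/eqP; rewrite -subr_eq0; apply/eqP; apply: left_unit; first exact: pN.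
  by exists g; apply: gprojP.
exists e; split=> // s Ns; split; first exact: lu.
rewrite [s]gproj_sum gmul_suml; apply: eq_bigr => g _.
set t := gproj s g; have Nt : N t by exact: pN.
have ht : homog t by exists g; apply: gprojP.
apply/esym/eqP; rewrite -subr_eq0; apply/eqP.
(* No second chain is needed: [q (t - t e)] lies in [N], so [e] fixes it on the left and [t - t e]
   annihilates it. *)
apply: (semiprime_hom spQ); first exact: homr.
have Nx : N (t - gmul t e) by apply: subspaceB => //; apply: Nr.
move=> q _; rewrite -gmulA gmulBl -[gmul (gmul t e) _]gmulA lu ?subrr //.
exact: Nl.
Qed.

End IdealUnit.

(** * Identities bounding nilpotency classes *)

Section LocallyFiniteSub.
Variables (F : finFieldType) (G : finGroupType) (S : set (freeAlg F G)).
Hypothesis lfS : locally_finite (variety_of S).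

(** Local finiteness speaks of abstract algebras; this transports it to subalgebras inside [B]. *)
Lemma gen_finite (B : gradedAlg F G) (xs : seq B) : variety_of S B ->
  {in xs, forall x, homog x} -> exists D : seq B, forall x, gen [set` xs] x ->
    x \in D.
Proof.
move=> SB hxs; have hD : graded_subalgebra (gen [set` xs]) by apply: gen_graded.
have [sD mD] := gen_subalgebra [set` xs].
have fD : finitely_generated (subalg hD) -> finite_set [set: subalg hD].
  by apply: lfS; apply: variety_sub.
suff /fD : finitely_generated (subalg hD).
  move=> /finite_seqP[ds dsT]; exists (map val ds) => x Dx.
  have Dx' : x \in gen [set` xs] by apply/mem_set.
  apply/mapP; exists (Sub x Dx' : subalg hD); last by rewrite SubK.
  by have : [set: subalg hD] (Sub x Dx') by []; rewrite dsT.
pose ys : seq (subalg hD) := pmap insub xs.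
exists [set` ys]; split; first exact: finite_seq.
have [sY mY] := gen_subalgebra (A := subalg hD) [set` ys].
have vl : linear (val : subalg hD -> B) by exact: subalg_valP.
have h : gen [set` xs] `<=` [set x | exists2 y,
  gen (A := subalg hD) [set` ys] y & val y = x].
  apply: gen_min => [|x /= xsx]; last first.
    have Dx : x \in gen [set` xs] by apply/mem_set; exact: (sub_gen xsx).
    exists (Sub x Dx : subalg hD); last by rewrite SubK.
    by apply: (sub_gen (A := subalg hD)); rewrite /= mem_pmap_sub SubK.
  split.
    apply/subspaceP; split=> [|c _ _ [u gu <-] [w gw <-]].
      by exists 0; [exact: subspace0 sY | exact: lin0 vl].
    exists (c *: u + w); last exact: subalg_valP.
    exact: subspaceL sY gu gw.
  move=> _ _ [u gu <-] [w gw <-]; exists (gmul (u : subalg hD) w).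
    exact: mY.
  exact: subalg_mulE.
apply/seteqP; split=> // z _.
have /h[y gy /val_inj <-] : gen [set` xs] (val z) by apply/set_mem; exact: valP.
exact: gy.
Qed.

End LocallyFiniteSub.

Section LongWords.
Variables (F : finFieldType) (G : finGroupType) (A : gradedAlg F G) (n : nat).
Hypotheses (n0 : (0 < n)%N) (An : fcard A n).
Local Notation FX := (freeAlg F G).
Let hT := TG_ideal_T_G A.
Local Notation Rf := (quot hT.1).

Lemma relfree_eval (v : gvar G -> A) : graded_val v ->
  exists phi : Rf -> A, [/\ linear phi, {morph phi : a b / gmul a b},
    forall g a, gcomp Rf g a ->
      gcomp A g (phi a) & forall f, phi (quot_pi hT.1 f) = eval v f].
Proof.
move=> gv; pose phi (q : Rf) := eval v (repr q).
have phiE f : phi (quot_pi hT.1 f) = eval v f.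
  apply/eqP; rewrite -subr_eq0 -(linB (eval_linear v)); apply/eqP.
  exact: (quot_repr hT.1 f) v gv.
exists phi; split=> // [c a b|a b|g _ [f gf <-]].
- have [x ->] := quot_pi_surj a; have [y ->] := quot_pi_surj b.
  by rewrite -(quot_pi_linear hT.1) !phiE eval_linear.
- have [x ->] := quot_pi_surj a; have [y ->] := quot_pi_surj b.
  by rewrite -(quot_pi_mul hT.1) !phiE evalM.
- by rewrite phiE; apply: eval_gcomp.
Qed.

Lemma mulw_morph (B C : gradedAlg F G) (h : B -> C) s x :
  {morph h : a b / gmul a b} -> h (mulw s x) = mulw (map h s) (h x).
Proof. by move=> hM; elim: s => //= a s <-; apply: hM. Qed.

Lemma pw_morph (B C : gradedAlg F G) (h : B -> C) x k :
  {morph h : a b / gmul a b} -> h (pw x k) = pw (h x) k.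
Proof. by move=> hM; elim: k => //= k <-; apply: hM. Qed.

Lemma ford_pw (f : FX) k : ford k.+1 (pw f k).
Proof. by elim: k => [|k IH];
  [exact: ford1 | exact: (fordM (@ford1 F G f) IH)]. Qed.

Lemma ford_mulw (I : Type) (s : seq I) (y x : I -> FX) (y0 x0 : FX) k :
  (forall i, ford k (y i - x i)) -> ford k (y0 - x0) ->
  ford k (mulw (map y s) y0 - mulw (map x s) x0).
Proof.
move=> hk h0; elim: s => //= i s IH; set u := mulw _ _; set w := mulw _ _.
have -> : gmul (y i) u - gmul (x i) w = gmul (y i - x i) u + gmul (x i) (u - w).
  by rewrite gmulBl gmulBr addrA subrK.
apply: subspaceD (@ford_subspace F G k) _ _.
  exact: ford_le (leq_addr _ _) (fordM (hk i) (@ford1 F G u)).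
exact: ford_le (leq_addl _ _) (fordM (@ford1 F G (x i)) IH).
Qed.

(* The component [(1 - e) x (1 - e)]. *)
Definition peirce (B : gradedAlg F G) (e x : B) : B :=
  x - gmul e x - gmul (x - gmul e x) e.

Lemma peirce_morph (B C : gradedAlg F G) (h : B -> C) e x : linear h ->
  {morph h : a b / gmul a b} -> h (peirce e x) = peirce (h e) (h x).
Proof. by move=> hl hM; rewrite /peirce !(linB hl) !hM !(linB hl) !hM. Qed.

Lemma peirce_ford (e x : FX) k : ford k e -> ford k (peirce e x - x).
Proof.
move=> he; have sk := @ford_subspace F G k.
have -> : peirce e x - x = - gmul e x - gmul (x - gmul e x) e.
  by rewrite /peirce addrAC [x - _]addrC addrK.
apply: (subspaceB sk).
  rewrite -scaleN1r; apply: subspaceZ sk _.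
  exact: ford_le (leq_addr _ _) (fordM he (@ford1 F G x)).
exact: ford_le (leq_addl _ _) (fordM (@ford1 F G _) he).
Qed.

Lemma subset_map (T : eqType) (U : eqType) (h : T -> U) (s : seq T) (u : seq U) :
  {subset u <= map h s} -> exists2 t, {subset t <= s} & u = map h t.
Proof.
elim: u => [|x u IH] us; first by exists [::].
have /mapP[y ys ->] := us x (mem_head _ _).
have [z zu|t ts ->] := IH; first by apply: us; rewrite inE zu orbT.
by exists (y :: t) => // z; rewrite inE => /orP[/eqP->|/ts].
Qed.

(** The polynomial [f] is the product of the corner components of the variables with respect to a
    lift of [e]; [nil_pigeonhole], applied to values in [A], makes it an identity. *)
Lemma long_word (d : nat -> G) : exists2 f : FX, T_G A f &
  ford n.+2 (f - mulw [seq fvar F (d i, i) | i <- iota 0 n] (fvar F (d n, n))).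
Proof.
pose xi i : Rf := quot_pi hT.1 (fvar F (d i, i)).
have hxi i : gcomp Rf (d i) (xi i) by exists (fvar F (d i, i)) => //;
  exact: fvar_gcomp.
pose xs : seq Rf := [seq xi i | i <- iota 0 n.+1].
have xsh : {in xs, forall x, homog x} by move=> _ /mapP[i _ ->]; exists (d i).
have RfA : variety_of (@dset F G n) Rf.
  by apply: relfree_variety; exact: dset_identity.
have [D inD] := gen_finite (dset_locally_finite n0) RfA xsh.
have [sX mX] := gen_subalgebra [set` xs].
have [e [Xe e1 ee pe]] := principal_idempotent sX mX inD.
(* Since [e] is idempotent, the power of [eps0] with exponent [n + 2] still lifts [e], and it has
   order at least [n + 2]. *)
have [eps0 epsE0] := quot_pi_surj e; pose eps := pw eps0 n.+1.
have epsE : quot_pi hT.1 eps = e.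
  rewrite /eps (pw_morph (C := Rf) _ _ (quot_pi_mul hT.1)) -epsE0.
  exact: pw_idem ee.
pose y i : FX := peirce eps (fvar F (d i, i)); pose a i := peirce e (xi i).
have aE i : quot_pi hT.1 (y i) = a i.
  by rewrite (peirce_morph (C :=
    Rf) _ _ (quot_pi_linear hT.1) (quot_pi_mul hT.1)) epsE.
exists (mulw [seq y i | i <- iota 0 n] (y n)); last first.
  by apply: ford_mulw => [i|]; apply: peirce_ford; apply: ford_pw.
move=> v gv; have [phi [phil phiM phig phiE]] := relfree_eval gv.
rewrite -phiE (mulw_morph (C := Rf) _ _ (quot_pi_mul hT.1)) (mulw_morph _ _ phiM).
rewrite -!map_comp aE (eq_map (g := phi \o a)); last by move=> i /=; rewrite aE.
pose N := [set x | [/\ gen [set` xs] x, gmul e x = 0, gmul x e = 0 & homog x]].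
have mN x z : N x -> N z -> N (gmul x z).
  move=> [Xx ex xe hx] [Xz ez ze hz]; split; last exact: homogM.
  - exact: mX.
  - by rewrite gmulA ex gmul0l.
  - by rewrite -gmulA ze gmul0r.
have Na i : i \in iota 0 n.+1 -> N (a i).
  move=> il; have Xi : gen [set` xs] (xi i)
    by exact: (sub_gen (map_f xi il : [set` xs] _)).
  have Xu : gen [set` xs] (xi i - gmul e (xi i))
    by apply: (subspaceB sX) => //; apply: mX.
  split.
  - by apply: (subspaceB sX) => //; apply: mX.
  - have eu : gmul e (xi i - gmul e (xi i)) = 0.
      by rewrite gmulBr gmulA ee subrr.
    by rewrite /a /peirce gmulBr gmulA eu gmul0l subrr.
  - by rewrite /a /peirce gmulBl -[gmul (gmul _ e) e]gmulA ee subrr.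
  have hu : gcomp Rf (d i) (xi i - gmul e (xi i)).
    apply: (subspaceB (subspace_gcomp Rf _) (hxi i)).
    by rewrite -[d i]mul1g; apply: gcompM.
  exists (d i); apply: (subspaceB (subspace_gcomp Rf _) hu).
  by rewrite -[d i]mulg1; apply: gcompM.
have hphi x : N x -> homog (phi x) by move=> [_ _ _ [g gx]]; exists g;
  apply: phig.
apply: (nil_pigeonhole An); first by rewrite size_map size_iota.
- move=> _ /mapP[i il ->]; apply/hphi/Na; move: il; rewrite !mem_iota.
  by move=> /andP[-> il]; apply: ltn_trans il _.
- by apply/hphi/Na; rewrite mem_iota add0n ltnSn.
move=> b u /subset_map[t' ts' eu]; case: t' ts' eu => [|i t] ts' // [-> ->].
rewrite belast_map last_map.
have {}ts' j : j \in i :: t -> N (a j).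
  move=> /ts'; rewrite mem_iota => /andP[_ jn]; apply: Na; rewrite mem_iota.
  exact: ltn_trans jn _.
pose c := mulw [seq a j | j <- belast i t] (a (last i t)).
have Nc : N c.
  apply: (mulw_in mN) => [_ /mapP[j jt ->]|]; apply: ts'; last exact: mem_last.
  exact: mem_belast.
rewrite map_comp -(mulw_morph _ _ phiM) -/c => c1.
(* Only [phi c] is known to have degree 1. If it is nonzero, its degree is that of [c], so an
   idempotent power of [c] has degree 1 in the relatively free algebra and vanishes by
   principality. *)
have [c0|c0] := eqVneq (phi c) 0; first by exists 0%N.
have [Xc _ _ [g gc]] := Nc; have g1 := gcomp_inj (phig _ _ gc) c1 c0.
have [k kk] := @idempotent_power _ _ Rf D c (fun k => inD _ (pw_in k mX Xc)).
exists k; rewrite -(pw_morph _ _ phiM) (_ : pw c k = 0); first exact: lin0.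
have [Xk ek ke _] := pw_in k mN Nc.
by apply: pe => //; apply: pw_gcomp1; rewrite -g1.
Qed.

Lemma long_word_identities : exists S : set FX, [/\ finite_set S, variety_of S A &
  forall d : nat -> G, exists2 f, S f &
    ford n.+2 (f - mulw [seq fvar F (d i, i) | i <- iota 0 n] (fvar F (d n, n)))].
Proof.
have /choice[f hf] (es : n.+1.-tuple G) : exists f : FX, T_G A f /\ ford n.+2
    (f - mulw [seq fvar F (nth 1%g es i,
      i) | i <- iota 0 n] (fvar F (nth 1%g es n, n))).
  by have [f] := long_word (nth 1%g es); exists f.
exists (range f); split; first exact: finite_image.
  by move=> _ [es _ <-]; exact: (hf es).1.
move=> d; have ses : size (mkseq d n.+1) == n.+1 by rewrite size_mkseq.
exists (f (Tuple ses)); first by exists (Tuple ses).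
have := (hf (Tuple ses)).2; rewrite /= nth_mkseq //.
suff -> : [seq fvar F (nth 1%g (mkseq d n.+1) i, i) | i <- iota 0 n] =
  [seq fvar F (d i, i) | i <- iota 0 n] by [].
apply/eq_in_map => i; rewrite mem_iota => /andP[_ il].
by rewrite nth_mkseq // ltnS ltnW.
Qed.

Section Nilpotent.
Variables (S : set FX) (B : gradedAlg F G) (J : set B).
Hypothesis hS : forall d : nat -> G, exists2 f, S f &
  ford n.+2 (f - mulw [seq fvar F (d i, i) | i <- iota 0 n] (fvar F (d n, n))).
Hypotheses (SB : variety_of S B) (hJ : graded_ideal J).

(** Substituting the [n + 1] letters from [J] into the identity replaces their product by words of
    length at least [n + 2] in elements of [J]. *)
Lemma Jp_stable : Jp J n.+1 `<=` Jp J n.+2.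
Proof.
have iJ := graded_ideal_ideal hJ; have [sJ _] := iJ.
move=> z /(Jp_words hJ); move: z; apply: span_sub (Jp_subspace J n.+2) _.
move=> _ [s [y [ss Js ->]]].
pose s' i := nth 0 s i.
have Js' i : J (s' i) /\ homog (s' i).
  have [il|il] := ltnP i (size s); first by apply: Js; apply: mem_nth.
  rewrite /s' nth_default //; split; first exact: subspace0.
  by exists 1%g; apply: gcomp0.
have /choice[d hd] i : exists g, gcomp B g (s' i) by exact: (Js' i).2.
have [f Sf fo] := hS d.
pose v (x : gvar G) : B := if x.1 == d x.2 then s' x.2 else 0.
have gv : graded_val v.
  by move=> x; rewrite /v; case: eqP => [->|_] //; apply: gcomp0.
have Jv (x : gvar G) : J (v x).
  by rewrite /v; case: eqP => _; [exact: (Js' _).1 | exact: subspace0].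
have es : s = rcons [seq s' i | i <- iota 0 n] (s' n).
  apply: (@eq_from_nth _ 0); rewrite ?size_rcons ?size_map ?size_iota //.
  move=> i; rewrite ss ltnS leq_eqVlt => /predU1P[->|il].
    by rewrite nth_rcons size_map size_iota ltnn eqxx.
  by rewrite nth_rcons size_map size_iota il (nth_map 0%N) ?size_iota // nth_iota.
have := ford_Jp y iJ Jv fo; rewrite (linB (eval_linear v)) (SB Sf gv) sub0r.
rewrite (mulw_morph _ _ (evalM v)) -map_comp eval_var.
rewrite (eq_map (g := s')); last by move=> i; rewrite /= eval_var /v /= eqxx.
rewrite /v /= eqxx es mulw_rcons => h.
rewrite -[gmul _ _]opprK -scaleN1r; apply: subspaceZ (Jp_subspace J n.+2) _.
by move: h; rewrite -[- mulw _ _]scaleN1r gmulZl scaleN1r.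
Qed.

(** The chain of the [Jp J l] is constant from [n + 1] on, so it can reach zero only by then. *)
Lemma Jp_nilpotent k : Jp J k `<=` [set 0] -> Jp J n.+1 `<=` [set 0].
Proof.
move=> Jk; have [kn|nk] := leqP k n.+1.
  exact: subset_trans (Jp_le (graded_ideal_ideal hJ) kn) Jk.
suff h l : Jp J (n.+1 + l) `<=` Jp J (n.+1 + l.+1).
  have {}h l : Jp J n.+1 `<=` Jp J (n.+1 + l).
    by elim: l => [|l IH]; [rewrite addn0 | exact: subset_trans IH (h l)].
  by apply: subset_trans Jk; rewrite -(subnKC (ltnW nk)).
elim: l => [|l IH]; first by rewrite addn0 addn1; exact: Jp_stable.
rewrite !addnS in IH *; apply: span_mono => _ [a [y [Ja Jy ->]]].
by exists a, y; split=> //; apply: IH.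
Qed.

End Nilpotent.
End LongWords.

(** * Finite semiprime algebras *)

Section Minimal.
Variables (F : fieldType) (G : finGroupType) (Q : gradedAlg F G) (n : nat).
Hypothesis Qn : fcard Q n.
Implicit Types (K T N : set Q).

(** A monotone count of elements, strict on proper inclusions, for the extremal choices below. *)
Lemma set_card : exists c : set Q -> nat, [/\ forall K, (c K <= n)%N,
  forall K K', K `<=` K' -> (c K' <= c K)%N -> K' `<=` K &
  forall K K', K `<=` K' -> (c K <= c K')%N].
Proof.
have [D Dn QD] := Qn; pose l K := [seq x <- undup D | `[< K x >]].
have lE K x : (x \in l K) = `[< K x >] by rewrite mem_filter mem_undup QD andbT.
have lu K : uniq (l K) by rewrite filter_uniq ?undup_uniq.
have lS K K' : K `<=` K' -> {subset l K <= l K'}.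
  by move=> KK' x; rewrite !lE => /asboolP/KK' ?; apply/asboolP.
exists (fun K => size (l K)); split=> [K|K K' KK' cK|K K' KK'].
- by apply: leq_trans Dn; apply: uniq_leq_size.
- have [_ e] := uniq_min_size (lu K) (lS _ _ KK') cK.
  by move=> x /asboolP; rewrite -lE -e lE => /asboolP.
- exact/uniq_leq_size/lS.
Qed.

Definition nonzero K := exists2 x, K x & x != 0.

Definition minimal T := [/\ graded_ideal T, nonzero T &
  forall K, graded_ideal K -> nonzero K -> K `<=` T -> T `<=` K].

Lemma exists_minimal N : graded_ideal N -> nonzero N ->
  exists2 T, minimal T & T `<=` N.
Proof.
move=> hN nN; have [c [_ cinj _]] := set_card.
pose P k := `[< exists K, [/\ graded_ideal K, nonzero K, K `<=` N & c K = k] >].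
have P0 : exists k, P k by exists (c N); apply/asboolP; exists N; split.
have [_ /asboolP[T [hT nT TN <-]] minT] := ex_minnP P0.
exists T => //; split=> // K hK nK KT; apply: (cinj _ _ KT); apply: minT.
by apply/asboolP; exists K; split=> //; apply: subset_trans TN.
Qed.

Lemma minimalI T T' : minimal T -> minimal T' -> T <> T' ->
  forall x y, T x -> T' y -> gmul x y = 0.
Proof.
move=> [hT nT mT] [hT' nT' mT'] TT' x y Tx Ty.
have hI := graded_idealI hT hT'; apply/eqP; apply: contraT => xy0.
case: TT'; have nI : nonzero (T `&` T').
  by exists (gmul x y) => //; split;
    [exact: (hT.2 y x Tx).2 | exact: (hT'.2 x y Ty).1].
apply/seteqP; split.
  by apply: subset_trans (mT _ hI nI (@subIsetl _ _ _)) (@subIsetr _ _ _).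
by apply: subset_trans (mT' _ hI nI (@subIsetr _ _ _)) (@subIsetl _ _ _).
Qed.

Fixpoint sumid (Ts : seq (set Q)) : set Q :=
  if Ts is T :: Ts' then [set x | exists u v, [/\ T u, sumid Ts' v & x = u + v]]
  else [set 0].

Lemma sumid_graded Ts : {in Ts, forall T, graded_ideal T} ->
  graded_ideal (sumid Ts).
Proof.
elim: Ts => [|T Ts IH] hTs; first exact: graded_ideal0.
have /graded_idealP[[sT mT] pT] : graded_ideal T by apply/hTs/mem_head.
have /graded_idealP[[sS mS] pS] : graded_ideal (sumid Ts).
  by apply: IH => T' T'Ts; apply: hTs; rewrite inE T'Ts orbT.
apply/graded_idealP; split; first split.
- apply/subspaceP; split.
    by exists 0, 0; rewrite addr0; split=> //; apply: subspace0.
  move=> c _ _ [u [v [Tu Sv ->]]] [u' [v' [Tu' Sv' ->]]].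
  exists (c *: u + u'), (c *: v + v'); split; try exact: subspaceL.
  by rewrite scalerDr addrACA.
- move=> a _ [u [v [Tu Sv ->]]]; have [? ?] := mT a u Tu; have [? ?] := mS a v Sv.
  split; first by exists (gmul a u), (gmul a v); rewrite gmulDr.
  by exists (gmul u a), (gmul v a); rewrite gmulDl.
- move=> _ g [u [v [Tu Sv ->]]]; exists (gproj u g), (gproj v g).
  by split; [exact: pT | exact: pS | rewrite -[u]scale1r gprojL !scale1r].
Qed.

Lemma sumid_sub Ts (W : set Q) : subspace W -> {in Ts, forall T, T `<=` W} ->
  sumid Ts `<=` W.
Proof.
move=> sW; elim: Ts => [|T Ts IH] TW x; first by move->; apply: subspace0.
move=> [u [v [Tu Sv ->]]]; apply: subspaceD => //.
  exact: (TW T (mem_head _ _)).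
by apply: IH Sv => T' T'Ts; apply: TW; rewrite inE T'Ts orbT.
Qed.

Lemma sub_sumid Ts T : {in Ts, forall T, graded_ideal T} -> T \in Ts ->
  T `<=` sumid Ts.
Proof.
elim: Ts => // T' Ts IH hTs; rewrite inE => /predU1P[->|TTs] x Tx.
  exists x, 0; rewrite addr0; split=> //.
  have /graded_ideal_ideal[sS _] : graded_ideal (sumid Ts).
    by apply: sumid_graded => T'' T''Ts; apply: hTs; rewrite inE T''Ts orbT.
  exact: subspace0.
exists 0, x; rewrite add0r; split=> //.
  by have [sT' _] := graded_ideal_ideal (hTs T' (mem_head _ _)); exact: subspace0.
by apply: IH => // T'' T''Ts; apply: hTs; rewrite inE T''Ts orbT.
Qed.

Hypothesis spQ : semiprime Q.

Lemma minimal_sq T : minimal T -> exists x y, [/\ T x, T y & gmul x y != 0].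
Proof.
move=> [hT [x Tx x0] _]; apply: contrapT => nT; move/eqP: x0; apply.
apply: (spQ hT) Tx => u v Tu Tv; apply/eqP; apply: contraT => uv.
by case: nT; exists u, v.
Qed.

(** A minimal ideal is prime in the sense of [prime_bound]: if [a y b = 0] for all [y], minimality
    puts [T] inside both annihilating ideals, and [semiprime_cube] makes [T] zero. *)
Lemma minimal_bound m T g (xs : seq Q) : (0 < m)%N -> variety_of (dset m) Q ->
  minimal T -> uniq xs -> {in xs, forall x, T x /\ gcomp Q g x} ->
    (size xs <= m)%N.
Proof.
move=> m0 Qm minT uxs Txs; have [hT nT mT] := minT.
apply: (prime_bound hT _ m0 Qm uxs Txs) => a b Ta Tb ha hb a0 b0.
apply: contrapT => nab.
have [y hy|K1 [K2 [h1 h2 K1a K2b h12]]] := @annihilating_ideals _ _ _ a b ha hb.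
  by apply/eqP; apply: contraT => ny; case: nab; exists y.
have T1 : T `<=` K1.
  apply: subset_trans (mT _ (graded_idealI h1 hT) _ (@subIsetr _ _ _))
    (@subIsetl _ _ _).
  by exists a.
have T2 : T `<=` K2.
  apply: subset_trans (mT _ (graded_idealI h2 hT) _ (@subIsetr _ _ _))
    (@subIsetl _ _ _).
  by exists b.
move/eqP: a0; apply; apply: (semiprime_cube spQ hT) Ta => x q y Tx Ty.
by apply: h12; [exact: T1 | exact: T2].
Qed.

(** Take the largest sum [N] of minimal ideals, with unit [e]. For a homogeneous [x] outside [N],
    [x - x e] is a nonzero annihilator of [N]; a minimal ideal inside that annihilator has nonzero
    square, so it is not in [N] and would enlarge the sum. *)
Lemma semiprime_decomposition : exists Ts : seq (set Q),
  [/\ uniq Ts, {in Ts, forall T, minimal T} & sumid Ts = setT].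
Proof.
have [c [cn cinj cmon]] := set_card.
pose P k := `[< exists Ts : seq (set Q),
  [/\ uniq Ts, {in Ts, forall T, minimal T} & c (sumid Ts) = k] >].
have P0 : exists k, P k by exists (c (sumid [::])); apply/asboolP; exists [::].
have Pn k : P k -> (k <= n)%N by move=> /asboolP[Ts [_ _ <-]].
have [_ /asboolP[Ts [uTs mTs <-]] maxTs] := ex_maxnP P0 Pn.
exists Ts; split=> //; apply: contrapT => nTs.
have hTs : {in Ts, forall T, graded_ideal T} by move=> T /mTs[].
have hS := sumid_graded hTs; set N := sumid Ts in nTs hS *.
have [[sN mN] pN] := (graded_idealP N).1 hS.
have [x hx Nx] : exists2 x, homog x & ~ N x.
  apply: contrapT => nx; apply: nTs; apply/seteqP; split=> // x _.
  rewrite [x]gproj_sum; apply: subspace_sumP sN _ => g _.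
  by apply: contrapT => ng; apply: nx; exists (gproj x g) => //; exists g;
    apply: gprojP.
have [e [Ne e1 eN]] := ideal_unit spQ Qn hS.
have iI : ideal [set x | forall y, N y -> gmul x y = 0].
  by apply: ideal_lann => a y Ny; exact: (mN a y Ny).1.
have nK : nonzero (core [set x | forall y, N y -> gmul x y = 0]).
  exists (x - gmul x e); last first.
    rewrite subr_eq0; apply/eqP => xe; apply: Nx; rewrite xe;
      exact: (mN x e Ne).1.
  apply: core_hom; first exact: iI.1.
    have [g gx] := hx; exists g; apply: (subspaceB (subspace_gcomp Q g)) => //.
    by rewrite -[g]mulg1; apply: gcompM.
  by move=> y Ny; rewrite gmulBl -gmulA (eN y Ny).1 subrr.
have [M minM MK] := exists_minimal (core_graded iI) nK.
have MN : ~ M `<=` N.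
  move=> MN; have [u [v [Mu Mv]]] := minimal_sq minM.
  by rewrite (core_sub iI.1 (MK u Mu)) ?eqxx //; apply: MN.
have MTs : M \notin Ts by apply/negP => /(sub_sumid hTs).
have hMTs : {in M :: Ts, forall T, minimal T}.
  by move=> T; rewrite inE => /predU1P[->|/mTs].
have NS : N `<=` sumid (M :: Ts).
  move=> y Ny; exists 0, y; rewrite add0r; split=> //.
  by have [/graded_ideal_ideal[sM _] _ _] := minM; exact: subspace0.
apply: MN; apply: subset_trans (cinj _ _ NS _).
  by apply: sub_sumid (mem_head _ _) => T /hMTs[].
by apply: maxTs; apply/asboolP; exists (M :: Ts); split=> //=; rewrite MTs.
Qed.

End Minimal.

(** * Generators of critical algebras *)

Section CriticalGenerators.
Variables (F : finFieldType) (G : finGroupType) (S : set (freeAlg F G)) (n : nat).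
Hypotheses (n0 : (0 < n)%N) (dS : dset n `<=` S).
Hypothesis wS : forall d : nat -> G, exists2 f, S f &
  ford n.+2 (f - mulw [seq fvar F (d i, i) | i <- iota 0 n] (fvar F (d n, n))).
Variables (B : gradedAlg F G) (k : nat).
Hypotheses (SB : variety_of S B) (Bk : fcard B k).

Lemma Jp_zero (J : set B) l : graded_ideal J -> Jp J l `<=` [set 0] ->
  Jp J n.+1 `<=` [set 0].
Proof. by move=> hJ Jl x; apply: (Jp_nilpotent wS SB hJ Jl). Qed.

Lemma max_nilpotent_ideal : exists J : set B, [/\ graded_ideal J,
  Jp J n.+1 `<=` [set 0] &
  forall (K : set B) l, graded_ideal K -> Jp K l `<=` [set 0] -> J `<=` K ->
    K `<=` J].
Proof.
have [c [ck cinj _]] := set_card Bk.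
pose P j := `[< exists J : set B, [/\ graded_ideal J, Jp J n.+1 `<=` [set 0] &
  c J = j] >].
have P0 : exists j, P j.
  exists (c [set 0]); apply/asboolP; exists [set 0]; split=> //.
    exact: graded_ideal0.
  apply: span_sub; first by case: (graded_ideal0 B) => -[].
  by move=> _ [a [y [-> _ ->]]]; apply: gmul0l.
have Pk j : P j -> (j <= k)%N by move=> /asboolP[J [_ _ <-]].
have [_ /asboolP[J [hJ J0 <-]] maxJ] := ex_maxnP P0 Pk.
exists J; split=> // K l hK Kl JK; apply: (cinj _ _ JK); apply: maxJ.
by apply/asboolP; exists K; split=> //; apply: Jp_zero hK Kl.
Qed.

Variables (J : set B) (hJ : graded_ideal J).
Hypotheses (J0 : Jp J n.+1 `<=` [set 0])
  (maxJ : forall (K : set B) l, graded_ideal K -> Jp K l `<=` [set 0] ->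
    J `<=` K -> K `<=` J).
Local Notation Q := (quot hJ).
Local Notation pi := (quot_pi hJ : B -> Q).

Let sJ : subspace J := (graded_ideal_ideal hJ).1.

(** If [N] has square zero, its preimage [K] has its products in [J], so [2 l] factors from [K] give
    [l] from [J]. Hence [K] is nilpotent and inside [J] by maximality. *)
Lemma radical_quot_semiprime : semiprime Q.
Proof.
move=> N hN N2 q; have [x ->] := quot_pi_surj q => Nx.
apply/(quot_pi_eq0 hJ); have hK := preim_graded_ideal hN.
set K := _ @^-1` N in hK.
have KK a b : K a -> K b -> J (gmul a b).
  move=> Ka Kb; apply/(quot_pi_eq0 hJ).
  by rewrite (quot_pi_mul hJ); apply: N2.
suff K2 l : Jp K l.*2 `<=` Jp J l.
  apply: (maxJ hK (subset_trans (K2 n.+1) J0)) => //= y Jy.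
  rewrite /K /preimage /mkset ((quot_pi_eq0 hJ y).2 Jy).
  by have [sN _] := graded_ideal_ideal hN; apply: (subspace0 sN).
elim: l => // l IH; rewrite doubleS; apply: span_sub; first exact: Jp_subspace.
move=> _ [a [y [Ka Ky ->]]].
have sW := subspace_preim (gmul_linearr a) (Jp_subspace J l.+1).
apply: span_sub sW _ _ Ky => _ [b [z [Kb Kz ->]]].
rewrite /preimage /mkset gmulA; apply: JpS; first exact: KK.
exact: IH.
Qed.

Lemma quot_fcard : fcard Q k.
Proof.
have [s sk sB] := Bk; exists (map pi s); first by rewrite size_map.
by move=> q; have [x ->] := quot_pi_surj q; apply: map_f.
Qed.

Lemma gen_lift (X : set B) (Ts : seq (set Q)) : sumid Ts = setT ->
    {in Ts, forall T, minimal T} ->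
    (forall T q, T \in Ts -> T q -> homog q -> exists2 x, gen X x & pi x = q) ->
  forall x, exists2 y, gen X y & J (x - y).
Proof.
move=> sT mTs lX x; have [sX _] := gen_subalgebra X.
pose W : set Q := [set q | exists2 y, gen X y & pi y = q].
have sW : subspace W.
  apply/subspaceP; split=> [|c _ _ [u gu <-] [v gv <-]].
    by exists 0; [exact: (subspace0 sX) | exact: quot_pi0].
  by exists (c *: u + v); [exact: (subspaceL c sX gu gv) | exact: quot_pi_linear].
have : W (pi x).
  have : sumid Ts (pi x) by rewrite sT.
  apply: (sumid_sub sW) => T TTs q Tq; rewrite [q]gproj_sum.
  apply: subspace_sumP sW _ => g _; apply: (lX _ _ TTs).
    by have [hT _ _] := mTs T TTs; apply: graded_ideal_proj.
  by exists g; apply: gprojP.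
by move=> [y gy /esym/(quot_piP hJ) Jxy]; exists y.
Qed.

Lemma homog_lift q : homog q -> exists2 x, homog x & pi x = q.
Proof. by move=> [g [x gx <-]]; exists x => //; exists g. Qed.

Lemma sub_gen_homog (X W : set B) : subspace W -> subspace X ->
  (forall x g, X x -> X (gproj x g)) -> (X `&` @homog F G B) `<=` W -> X `<=` W.
Proof.
move=> sW sX pX XW x Xx; rewrite [x]gproj_sum; apply: subspace_sumP sW _ => g _.
by apply: XW; split; [exact: pX | exists g; apply: gprojP].
Qed.

Hypothesis critB : critical B.
Variable Ts : seq (set Q).
Hypotheses (uTs : uniq Ts) (mTs : {in Ts, forall T,
  minimal T}) (sTs : sumid Ts = setT).

(* With [L_i] the preimage of the [i]th minimal ideal, [L_i L_j <= J] for
   [i != j]; so a product involving letters from [2 l] of the [L_i] lies in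
   [J^l B], which vanishes for large [l]. *)
Lemma minimal_ideals_count : (size Ts <= n.+1.*2.+2)%N.
Proof.
rewrite leqNgt; apply/negP => rn; set r := size Ts in rn.
pose T (i : 'I_r) : set Q := nth set0 Ts i.
have TTs i : T i \in Ts by apply: mem_nth.
have mT i : minimal (T i) by apply: mTs.
have hT i : graded_ideal (T i) by have [] := mT i.
have TT i j x y : i != j -> T i x -> T j y -> gmul x y = 0.
  move=> ij; apply: minimalI => //; apply/eqP.
  by rewrite nth_uniq.
pose lett (o : option 'I_r) : set B :=
  (if o is Some i then [set x | T i (pi x)] else J) `&` @homog F G B.
apply: (@not_critical F G B 'I_r lett) => //.
- by move=> o x [].
- apply/seteqP; split=> // x _.
  have [sg _] := gen_subalgebra (\bigcup_o lett o).
  have lg o y : lett o y -> gen (\bigcup_o lett o) y.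
    by move=> oy; apply: sub_gen; exists o.
  have [|y gy Jxy] := gen_lift (X := \bigcup_o lett o) sTs mTs _ x.
    move=> T' q T'Ts T'q hq; have [y hy yq] := homog_lift hq; exists y => //.
    have iT : (index T' Ts < r)%N by rewrite index_mem.
    apply: (lg (Some (Ordinal iT))); split=> //;
      rewrite /mkset /T /= nth_index //.
    by rewrite yq.
  rewrite -[x](subrK y); apply: (subspaceD sg) => //.
  apply: (sub_gen_homog sg sJ) Jxy => [z g|z Jz]; first exact: graded_ideal_proj.
  exact: (lg None).
- move=> i e; have [x [y [Tx Ty xy0]]] :=
  minimal_sq radical_quot_semiprime (mT i).
  (* The other letters annihilate [T i] modulo [J]. If they generated [B], then [T i] would have
     square zero, against semiprimeness. *)
  pose D : set B := [set z | forall t, T i t -> gmul (pi z) t = 0].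
  have sD : subalgebra D.
    split.
      apply/subspaceP; split=> [t _|c u v Du Dv t Tt].
        by rewrite quot_pi0; exact: gmul0l.
      by rewrite quot_pi_linear gmul_linearl Du // Dv // scaler0 addr0.
    move=> u v Du Dv t Tt; rewrite (quot_pi_mul hJ) -gmulA Dv //.
    exact: gmul0r.
  have [z xz] := quot_pi_surj x; move/eqP: xy0; apply; rewrite xz.
  suff : D z by apply.
  have : gen (\bigcup_(o in [set o | o <> Some i]) lett o) z by rewrite e.
  apply: (gen_min sD) => {xz}z [[j|] /= oi [Lz _]] t Tt.
    by apply: (TT _ _ _ _ _ Lz Tt); apply/eqP => ji; apply: oi; rewrite ji.
  by rewrite (quot_pi_eq0 hJ z).2 //; exact: gmul0l.
pose LJ i l := span [set z | exists a y, [/\ T i (pi a), Jp J l y &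
  z = gmul a y]].
have LJS i l a y : T i (pi a) -> Jp J l y -> LJ i l (gmul a y).
  by move=> Ta Jy; apply: sub_span; exists a, y.
(* Adjacent letters with different tags multiply into [J], so a factor from [J] accounts for at most
   two tags. One more tag may come from the last letter, and one from an [L_i] still waiting at the
   front. *)
have mon_in U x : mon lett U x -> exists l, (#|U| <= l.*2.+1)%N /\ Jp J l x \/
    (#|U| <= l.*2.+2)%N /\ exists2 i, i \in U & LJ i l x.
  elim=> [o {}x ox|[j|] a W b [La _] _ [l IH]].
  - by exists 0%N; left; split=> //; case: o ox => [i|] _ /=;
    rewrite ?cards1 ?cards0.
  - have cW : (#|tagset (Some j) :|: W| <= #|W|.+1)%N.
      by rewrite /= cardsU1; case: (_ \notin _).
    case: IH => [[Wl Jb]|[Wl [i iW ib]]].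
      exists l; right; split; first exact: leq_trans cW _.
      by exists j; [rewrite /= finset.in_setU1 eqxx | exact: LJS].
    have [ij|ij] := eqVneq i j.
      exists l; right; rewrite /= -ij (finset.setUidPr _) ?finset.sub1set //;
        split=> //.
      have sW := subspace_preim (gmul_linearr a) (span_subspace _ : subspace
        (LJ i l)).
      exists i => //; apply: span_sub sW _ _ ib => _ [a' [y [Ta' Jy ->]]].
      rewrite /preimage /mkset gmulA; apply: LJS => //.
      by rewrite (quot_pi_mul hJ); exact: ((hT i).2 _ _ Ta').1.
    exists l.+1; left; split; first by rewrite doubleS; apply: leq_trans cW _.
    have sW := subspace_preim (gmul_linearr a) (Jp_subspace J l.+1).
    apply: span_sub sW _ _ ib => _ [a' [y [Ta' Jy ->]]].
    rewrite /preimage /mkset gmulA; apply: JpS => //; apply/(quot_pi_eq0 hJ).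
    by rewrite (quot_pi_mul hJ); apply: TT La Ta'; rewrite eq_sym.
  - rewrite /= finset.set0U; case: IH => [[Wl Jb]|[Wl [i iW ib]]].
      exists l.+1; left; split; last exact: JpS.
      by apply: leq_trans Wl _; rewrite doubleS !ltnS !leqW.
    exists l; right; split=> //; exists i => //.
    have sW := subspace_preim (gmul_linearr a) (span_subspace _ : subspace (LJ
      i l)).
    apply: span_sub sW _ _ ib => _ [a' [y [Ta' Jy ->]]].
    rewrite /preimage /mkset gmulA; apply: LJS => //.
    by rewrite (quot_pi_mul hJ); exact: ((hT i).2 _ _ Ta').1.
have iJ := graded_ideal_ideal hJ.
move=> x /mon_in[l]; rewrite finset.cardsT card_ord -/r => -[[rl Jx]|[rl [i _
  ix]]].
  apply: J0; apply: (Jp_le iJ _ Jx); rewrite -leq_double.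
  by move: (leq_trans rn rl); rewrite ltnS => /ltnW/ltnW.
have nl : (n.+1 <= l)%N.
  by rewrite -leq_double; move: (leq_trans rn rl); rewrite !ltnS => /ltnW.
elim: ix => // c u v [a [y [_ Jy ->]]] _ ->.
by rewrite (J0 (Jp_le iJ nl Jy)) gmul0r scaler0 addr0.
Qed.

(** Lift all homogeneous elements of the minimal ideals: the factors of the bound count the ideals,
    the degrees, and the elements of one degree in one ideal. *)
Lemma quot_generators : exists C : seq B,
  [/\ (size C <= n.+1.*2.+2 * #|G| * n)%N, {in C, forall x, homog x} &
    forall x, exists2 y, gen [set` C] y & J (x - y)].
Proof.
have Qn : variety_of (dset n) Q by apply: variety_quot => f /dS/SB.
have /choice[e he] (p : set Q * G) : exists xs : seq Q, p.1 \in Ts ->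
    [/\ (size xs <= n)%N, {in xs, forall x, p.1 x /\ gcomp Q p.2 x} &
      forall x, p.1 x /\ gcomp Q p.2 x -> x \in xs].
  have [pTs|] := boolP (p.1 \in Ts); last by exists [::].
  have [|xs [sxs xsP xsT]] :=
      @bounded_enum _ [set x | p.1 x /\ gcomp Q p.2 x] n; last by exists xs.
  by move=> xs; apply: (minimal_bound radical_quot_semiprime n0 Qn (mTs pTs)).
have /choice[l hl] (q : Q) : exists x : B, homog q -> homog x /\ pi x = q.
  by have [/homog_lift[x hx xq]|nq] := pselect (homog q); [exists x | exists 0].
pose E := [seq (T, g) | T <- Ts, g <- enum G].
have TE p : p \in E -> p.1 \in Ts by move=> /allpairsP[[T g] /= [? _ ->]].
exists [seq l q | q <- flatten (map e E)]; split.
- rewrite size_map; apply: (@leq_trans (size E * n)).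
    elim: E TE => //= p E IH TE; rewrite size_cat mulSn leq_add //.
      by have [] := he p (TE p (mem_head _ _)).
    by apply: IH => p' p'E; apply: TE; rewrite inE p'E orbT.
  rewrite leq_mul2r size_allpairs -cardE leq_mul2r minimal_ideals_count.
  by rewrite !orbT.
- move=> _ /mapP[q /flattenP[_ /mapP[p pE ->]] qp ->].
  have [_ ep _] := he p (TE p pE); have [_ gq] := ep q qp.
  by apply: (hl q _).1; exists p.2.
apply: (gen_lift sTs mTs) => T q TTs Tq [g gq];
  have [_ lq] := hl q (ex_intro _ g gq).
exists (l q) => //; apply: sub_gen; apply: map_f; apply/flattenP.
exists (e (T, g)); first by apply/map_f/allpairsP; exists (T, g);
  rewrite mem_enum.
by have [_ _] := he (T, g) TTs; apply.
Qed.

(** Add to [C] as few homogeneous elements of [J] as possible. Each is a piece that cannot be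
    omitted, and a product involving too many of them lies in [Jp J n.+1], which is zero. *)
Lemma critical_generators : exists gs : seq B,
  [/\ (size gs <= n.+1.*2.+2 * #|G| * n + n.+1)%N, {in gs, forall x, homog x} &
    gen [set` gs] = setT].
Proof.
have [C [sC hC genC]] := quot_generators; have [D _ BD] := Bk.
pose P j := `[< exists ls : seq B, [/\ size ls = j,
  {in ls, forall x, J x /\ homog x} & gen [set` C ++ ls] = setT] >].
have P0 : exists j, P j.
  pose ls := [seq x <- D | `[< J x /\ homog x >]].
  exists (size ls); apply/asboolP; exists ls; split=> //.
    by move=> x; rewrite mem_filter => /andP[/asboolP].
  apply/seteqP; split=> // x _; have [sg _] := gen_subalgebra [set` C ++ ls].
  have [y gy Jxy] := genC x; rewrite -[x](subrK y); apply: (subspaceD sg).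
    apply: (sub_gen_homog sg sJ) Jxy => [z g|z [Jz hz]];
      first exact: graded_ideal_proj.
    by apply: sub_gen; rewrite /= mem_cat mem_filter BD andbT orbC; apply/orP;
      left; apply/asboolP.
  by apply: gen_mono gy => z /=; rewrite mem_cat => ->.
have [_ /asboolP[ls [<- Jls genls]] minls] := ex_minnP P0.
have hls : {in ls, forall x, homog x} by move=> x /Jls[].
exists (C ++ ls); split=> //; last first.
  by move=> x; rewrite mem_cat => /orP[/hC|/hls].
rewrite size_cat leq_add // leqNgt; apply/negP => sls.
pose lett (o : option 'I_(size ls)) : set B :=
  if o is Some i then [set nth 0 ls i] else [set` C].
apply: (@not_critical F G B _ lett) critB.
- move=> [i|] x /=; last exact: hC.
  by move=> ->; apply/hls/mem_nth.
- apply/seteqP; split=> // x _; have : gen [set` C ++ ls] x by rewrite genls.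
  apply: gen_mono => z /=; rewrite mem_cat => /orP[zC|zls]; first by exists None.
  have iz : (index z ls < size ls)%N by rewrite index_mem.
  by exists (Some (Ordinal iz)) => //=; rewrite nth_index.
- move=> i gi; have il := ltn_ord i.
  suff : (size ls <= size (take i ls ++ drop i.+1 ls))%N.
    rewrite size_cat size_takel ?size_drop ?(ltnW il) // leqNgt.
    by rewrite -[X in (_ < X)%N](subnKC (ltnW il)) ltn_add2l ltn_sub2l.
  apply: minls; apply/asboolP; exists (take i ls ++ drop i.+1 ls); split=> //.
    by move=> x; rewrite mem_cat => /orP[/mem_take|/mem_drop]; apply: Jls.
  apply/seteqP; split=> // x _.
  have : gen (\bigcup_(o in [set o | o <> Some i]) lett o) x by rewrite gi.
  apply: gen_mono => z [[j|] /= ji]; last by rewrite !mem_cat => ->.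
  have {ji} : j != i by apply/eqP => ji'; apply: ji; rewrite ji'.
  move=> ji ->; rewrite !mem_cat; apply/orP; right; apply/orP.
  have [lij|lji] := ltnP j i.
    by left; rewrite -(nth_take 0 lij) mem_nth // size_takel // ltnW.
  right; have {lji} lij : (i < j)%N by rewrite ltn_neqAle lji andbT eq_sym.
  by rewrite -{1}(subnKC lij) -nth_drop mem_nth // size_drop ltn_sub2r //
    (leq_ltn_trans lij).
have iJ := graded_ideal_ideal hJ.
(* The last letter is not counted by [Jp], hence [l + 1]; more than [n + 1] pieces thus force
   [l > n]. *)
have mon_in U x : mon lett U x -> exists l, (#|U| <= l.+1)%N /\ Jp J l x.
  elim=> [o {}x ox|[j|] a W b La _ [l [Wl Jb]]].
  - by exists 0%N; split=> //; case: o ox => [i|] _ /=; rewrite ?cards1 ?cards0.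
  - exists l.+1; split.
      by rewrite /= cardsU1 -add1n leq_add // leq_b1.
    by apply: JpS => //; rewrite (La : a = _); apply: (Jls _ _).1; apply: mem_nth.
  - by exists l; rewrite /= finset.set0U; split=> //; apply: Jp_mull.
move=> x /mon_in[l [sl Jx]]; apply: J0; apply: (Jp_le iJ _ Jx).
by rewrite finset.cardsT card_ord in sl; rewrite -ltnS (leq_trans sls).
Qed.

End CriticalGenerators.

(** * Finiteness of the set of critical algebras *)

Section Isomorphism.
Variables (F : fieldType) (G : finGroupType).
Local Notation FX := (freeAlg F G).

(** Both algebras are quotients of the free algebra by the same kernel. *)
Lemma same_kernel_iso (B B' : gradedAlg F G) (u : gvar G -> B) (u' : gvar G ->
  B') :
    graded_val u -> graded_val u' ->
    (forall b, exists f, eval u f = b) -> (forall b, exists f, eval u' f = b) ->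
    (forall f, eval u f = 0 <-> eval u' f = 0) ->
  graded_iso B B'.
Proof.
move=> gu gu' /choice[s us] /choice[s' us'] ker.
pose phi b := eval u' (s b); pose psi b := eval u (s' b).
have phiE f : phi (eval u f) = eval u' f.
  apply/eqP; rewrite -subr_eq0 -(linB (eval_linear u')); apply/eqP/ker.
  by rewrite (linB (eval_linear u)) us subrr.
have psiE f : psi (eval u' f) = eval u f.
  apply/eqP; rewrite -subr_eq0 -(linB (eval_linear u)); apply/eqP/ker.
  by rewrite (linB (eval_linear u')) us' subrr.
have phil : linear phi.
  by move=> c a b; rewrite -[a]us -[b]us -eval_linear !phiE eval_linear.
exists (linpack phil); split; last first.
  by exists psi => [b|b]; [rewrite -[b]us [linpack _ _]phiE psiE
    | rewrite -[b]us' psiE; apply: phiE].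
split=> [a b|g a ga].
  by rewrite -[a]us -[b]us -evalM; rewrite ![linpack _ _]phiE evalM.
have -> : a = eval u (gproj (s a) g)
  by rewrite -eval_gproj // us (gproj_hom g ga) eqxx.
by rewrite [linpack _ _]phiE; apply: eval_gcomp (gprojP _ _).
Qed.

Lemma graded_iso_identity (B C : gradedAlg F G) f : graded_iso B C ->
  T_G B f <-> T_G C f.
Proof.
move=> [h [[hM hg] [h' hK h'K]]].
have hl : linear h by exact: linearP.
split=> idf v gv; last first.
  by apply: (can_inj hK); rewrite (hom_eval hl) // (lin0 hl); apply: idf => x;
    apply: hg.
have -> : v = h \o (fun x => gproj (h' (v x)) x.1).
  apply/funext => x /=; rewrite -(hom_gproj hl) // h'K.
  by rewrite (gproj_hom _ (gv x)) eqxx.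
by rewrite -(hom_eval hl) // idf ?(lin0 hl) // => x; apply: gprojP.
Qed.

End Isomorphism.

Section FiniteCriticals.
Variables (F : finFieldType) (G : finGroupType) (S : set (freeAlg F G)) (K : nat).
Local Notation FX := (freeAlg F G).
Hypothesis lfS : locally_finite (variety_of S).
Hypothesis genS : forall B : gradedAlg F G, variety_of S B -> critical B ->
  exists gs : seq B, [/\ (size gs <= K)%N, {in gs, forall x, homog x} &
    gen [set` gs] = setT].

(** Variables of index [K] or more are sent to 0, so that all such presentations factor through the
    one finite algebra of values of [xi]. *)
Definition presents (B : gradedAlg F G) (u : gvar G -> B) :=
  [/\ graded_val u, forall g i, (K <= i)%N -> u (g, i) = 0 &
    forall b, exists f, eval u f = b].

Lemma gens_present (B : gradedAlg F G) (gs : seq B) : (size gs <= K)%N ->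
  {in gs, forall x, homog x} -> gen [set` gs] = setT ->
  exists u : gvar G -> B, presents u.
Proof.
move=> sK hgs ggs.
pose u (x : gvar G) := if `[< gcomp B x.1 (nth 0 gs x.2) >] then nth 0 gs x.2
  else 0.
exists u; split=> [x|g i Ki|b].
- by rewrite /u; case: asboolP => // _; apply: gcomp0.
- by rewrite /u /= nth_default ?if_same // (leq_trans sK).
have ul := eval_linear u.
have : gen [set` gs] b by rewrite ggs.
apply: (gen_min (W := [set b | exists f, eval u f = b])) => [|x /= xgs].
  split; last by move=> _ _ [f <-] [h <-]; exists (gmul f h); apply: evalM.
  apply/subspaceP; split=> [|c _ _ [f <-] [h <-]]; first by exists 0;
    apply: lin0 ul.
  by exists (c *: f + h); apply: ul.
have [g gx] := hgs x xgs; exists (fvar F (g, index x gs)).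
by rewrite eval_var /u /= nth_index //; case: asboolP.
Qed.

Let hT := TG_ideal_Id (variety_of S).
Local Notation Rf := (quot hT.1).

Let p (x : gvar G) : FX := if (x.2 < K)%N then fvar F x else 0.
Let xi : gvar G -> Rf := quot_pi hT.1 \o p.

Lemma presents_factor (B : gradedAlg F G) (u : gvar G -> B) f :
  variety_of S B -> presents u -> eval xi f = 0 -> eval u f = 0.
Proof.
move=> SB [gu uK _]; rewrite quot_eval => /(quot_pi_eq0 hT.1) /(_ B SB u gu).
rewrite (hom_eval (eval_linear u)); last exact: evalM.
move=> e; rewrite -{}[RHS]e; apply: eval_ext => -[g i] _ /=.
rewrite /p /=; case: ltnP => iK; first by rewrite eval_var.
by rewrite (lin0 (eval_linear u)) uK.
Qed.

Lemma relfree_finite : exists D : seq Rf, forall f, eval xi f \in D.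
Proof.
pose xs : seq Rf := [seq quot_pi hT.1 (fvar F (g, i)) | g <- enum G,
  i <- iota 0 K].
have hxs : {in xs, forall x, homog x}.
  move=> _ /allpairsP[[g i] /= [_ _ ->]]; exists g.
  by exists (fvar F (g, i)) => //; apply: fvar_gcomp.
have SR : variety_of S Rf by apply: relfree_variety => f Sf B; apply.
have [D hD] := gen_finite lfS SR hxs; exists D => f; apply: hD.
apply: eval_in; first exact: gen_subalgebra.
move=> [g i]; rewrite /xi /= /p /=; case: ltnP => iK.
  by apply: sub_gen; rewrite /= allpairs_f ?mem_enum // mem_iota.
by rewrite quot_pi0; exact: (subspace0 (gen_subalgebra [set` xs]).1).
Qed.

(** The kernel of a presentation is determined by which of the finitely many values of [xi] it sends
    to 0, which [code] records; the kernel in turn determines the algebra up to isomorphism. *)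
Lemma finitely_many_critical_variety (A : gradedAlg F G) :
  finitely_many_critical (variety_of S).
Proof.
have [D hD] := relfree_finite; pose N := size D.
pose code (B : gradedAlg F G) (u : gvar G -> B) : {ffun 'I_N -> bool} :=
  [ffun i : 'I_N => `[< exists f, eval xi f = nth 0 D i /\ eval u f = 0 >]].
have code_ker (B B' : gradedAlg F G) (u : gvar G -> B) (u' : gvar G -> B') f :
    variety_of S B' -> presents u' -> code B u = code B' u' ->
    eval u f = 0 -> eval u' f = 0.
  move=> SB' pu' ec uf;
    have iD : (index (eval xi f) D < N)%N by rewrite index_mem.
  have : code B' u' (Ordinal iD).
    by rewrite -ec ffunE; apply/asboolP; exists f; rewrite nth_index.
  rewrite ffunE => /asboolP[f' [xf' uf']].
  rewrite nth_index // in xf'.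
  suff : eval u' (f - f') = 0 by rewrite (linB (eval_linear u')) uf' subr0.
  apply: presents_factor SB' pu' _.
  by rewrite (linB (eval_linear xi)) xf' subrr.
pose R c (B : gradedAlg F G) := variety_of S B /\
  exists u : gvar G -> B, presents u /\ code B u = c.
(* [A] fills the places of codes that belong to no presented algebra. *)
pose L (i : 'I_#|{ffun 'I_N -> bool}|) : gradedAlg F G :=
  if pselect (exists B, R (enum_val i) B) is left h then projT1 (cid h) else A.
exists #|{ffun 'I_N -> bool}|, L => B SB cB.
have [gs [sgs hgs ggs]] := genS SB cB; have [u pu] := gens_present sgs hgs ggs.
exists (enum_rank (code B u)); rewrite /L; case: pselect => [h|[]]; last first.
  by exists B; rewrite enum_rankK; split=> //; exists u.
case: cid => B' /= [SB' [u' [pu']]]; rewrite enum_rankK => ec.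
have [gu uK su] := pu; have [gu' uK' su'] := pu'.
by apply: (same_kernel_iso gu gu' su su') => f; split; apply: code_ker.
Qed.

End FiniteCriticals.

(** * Finite bases *)

Lemma fcard_remove (T U : eqType) (h : T -> U) (x : T) n : fcard T n.+1 ->
  (forall y, exists2 z, z != x & h z = y) -> fcard U n.
Proof.
move=> [s sn sT] hU; exists (map h (rem x (undup s))).
  rewrite size_map size_rem ?mem_undup // -ltnS prednK.
    exact: leq_trans (size_undup s) sn.
  by case: (undup s) (mem_undup s x) => //; rewrite sT.
move=> y; have [z zx <-] := hU y; apply: map_f.
by rewrite mem_rem_uniq ?undup_uniq // inE zx mem_undup sT.
Qed.

Lemma fcard_surj (T U : eqType) (h : T -> U) n : fcard T n ->
  (forall y, exists z, h z = y) -> fcard U n.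
Proof.
move=> [s sn sT] hU; exists (map h s) => [|y]; first by rewrite size_map.
by have [z <-] := hU y; apply: map_f.
Qed.

Section FiniteBasis.
Variables (F : fieldType) (G : finGroupType).
Local Notation FX := (freeAlg F G).

(** A proper subalgebra misses an element, and a nonzero ideal identifies a nonzero element with 0;
    either way one element can be spared. *)
Lemma section_fcard (B B' : gradedAlg F G) n : proper_graded_section B B' ->
  fcard B n.+1 -> fcard B' n.
Proof.
move=> [D hD C hC nDC] Bn; have sD : subspace D by have [_ []] := hD.
have D0 : (0 : B) \in D. exact: (mem_set (subspace0 sD)).
pose z0 : subalg hD := Sub 0 D0; pose h (x : B) : subalg hD := insubd z0 x.
have hK (z : subalg hD) : h (val z) = z by exact: valKd.
have [DT|nDT] := pselect (D = setT); last first.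
  have [x Dx] : exists x, ~ D x.
    by apply: contrapT => /forallNP nx; apply: nDT; apply/seteqP;
      split=> // x _; apply: contrapT (nx x).
  apply: (fcard_remove (h := fun y => quot_pi hC (h y) : quot hC) (x :=
    x) Bn) => q.
  have [z ->] := quot_pi_surj q; exists (val z); last by rewrite hK.
  by apply/eqP => zx; apply: Dx; rewrite -zx; apply/set_mem; exact: valP.
have sC : subspace C by have [sC _] := graded_ideal_ideal hC.
have [c Cc c0] : exists2 c, C c & c != 0.
  apply: contrapT => nC; apply: nDC; split=> //; apply/seteqP;
    split=> [c Cc|_ ->].
    by apply/eqP; apply: contrapT => /negP c0; apply: nC; exists c.
  exact: subspace0.
have Dn : fcard (subalg hD) n.+1.
  by apply: (fcard_surj (h := h) Bn) => z; exists (val z).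
apply: (fcard_remove (h := quot_pi hC : subalg hD -> quot hC) (x := c) Dn) => q.
have [z ->] := quot_pi_surj q; have [->|zc] := eqVneq z c; last by exists z.
exists 0; first by rewrite eq_sym.
by rewrite ((quot_pi_eq0 hC c).2 Cc) quot_pi0.
Qed.

(** Induction on the number of elements: a noncritical algebra inherits the identities common to its
    proper sections, which are smaller and still satisfy [S]. *)
Lemma finite_variety_identity (S : set FX) (f : FX) :
    (forall B : gradedAlg F G, variety_of S B -> critical B -> T_G B f) ->
  forall n (B : gradedAlg F G), fcard B n -> variety_of S B -> T_G B f.
Proof.
move=> crit; elim=> [|n IH] B Bn SB; first by have [[|//] _ /(_ 0)] := Bn.
have [/crit|ncB] := pselect (critical B); first exact.
have : variety_gen (proper_graded_section B) B.
  by apply: contrapT => nv; apply: ncB; split=> //; apply: fcard_finite Bn.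
apply=> B' BB'; apply: IH; first exact: section_fcard BB' Bn.
by case: BB' => D hD C hC _; apply/variety_quot/variety_sub.
Qed.

End FiniteBasis.

Section FinitelyBased.
Variables (F : finFieldType) (G : finGroupType) (S0 : set (freeAlg F G)).
Local Notation FX := (freeAlg F G).
Hypotheses (finS0 : finite_set S0) (lfS0 : locally_finite (variety_of S0)).
Hypothesis fmS0 : finitely_many_critical (variety_of S0).

(** Only the values of the finitely many variables of [f] matter, and they generate a finite
    subalgebra. *)
Lemma locally_finite_identity (S : set FX) (f : FX) : S0 `<=` S ->
    (forall n (B : gradedAlg F G), fcard B n -> variety_of S B -> T_G B f) ->
  forall B : gradedAlg F G, variety_of S B -> T_G B f.
Proof.
move=> S0S finf B SB v gv; pose xs := [seq v x | x <- fvars f].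
have hxs : {in xs, forall x, homog x}.
  by move=> _ /mapP[x _ ->]; exists x.1; apply: gv.
have hD : graded_subalgebra (gen [set` xs]) by apply: gen_graded.
have [ds dsP] := gen_finite lfS0 (fun g S0g => SB g (S0S g S0g)) hxs.
have Dn : fcard (subalg hD) (size (pmap insub ds : seq (subalg hD))).
  exists (pmap insub ds) => // z; rewrite mem_pmap_sub; apply: dsP.
  by apply/set_mem; exact: valP.
pose v' x := if x \in fvars f then v x else 0.
rewrite (@eval_ext _ _ _ _ v') => [|x xf]; last by rewrite /v' xf.
apply: (identity_sub hD f).1; first exact: finf Dn (variety_sub (hD := hD) SB).
  by move=> x; rewrite /v'; case: ifP => _ //; apply: gcomp0.
move=> x; rewrite /v'; case: ifP => xf; first by apply: sub_gen; apply: map_f.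
exact: (subspace0 (gen_subalgebra [set` xs]).1).
Qed.

(** Membership in [var A] is decided by critical algebras, of which there are finitely many; one
    identity of [A] is enough to exclude each of those outside [var A]. *)
Lemma subvariety_Cross (A : gradedAlg F G) : variety_of S0 A -> Cross (var A).
Proof.
move=> S0A; have sub B : var A B -> variety_of S0 B by move=> AB;
  apply: subset_trans AB.
split.
- by move=> B /sub; apply: lfS0.
- have [n [L hL]] := fmS0.
  (* [e i] separates [A] from [L i] where possible and is 0 where [L i] lies in [var A]. *)
  have /choice[e he] i : exists f,
    T_G A f /\ (T_G A `<=` T_G (L i) \/ ~ T_G (L i) f).
    have [AL|nAL] := pselect (T_G A `<=` T_G (L i)).
      exists 0; split; last by left.
      have [/graded_ideal_ideal[sA _] _] := TG_ideal_T_G A; exact: (subspace0 sA).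
    have [f Af Lf] : exists2 f, T_G A f & ~ T_G (L i) f.
      by apply: contrapT => nf; apply: nAL => f Af; apply: contrapT => Lf;
        apply: nf; exists f.
    by exists f; split=> //; right.
  pose S := S0 `|` range e.
  have S0S : S0 `<=` S by move=> f; left.
  have finS : finite_set S by rewrite finite_setU; split=> //;
    apply: finite_image.
  exists S; split=> // B; split=> [AB f [/(sub B AB)//|[i _ <-]]|SB f Af].
    by apply: AB; case: (he i).
  apply: (locally_finite_identity S0S _ SB).
  apply: finite_variety_identity => B' SB' cB'.
  have [i BL] := hL B' (subset_trans S0S SB') cB'.
  have [_ [AL|nL]] := he i; first exact/(graded_iso_identity f BL)/AL.
  by case: nL; apply/(graded_iso_identity (e i) BL); apply: SB'; right; exists i.
- have [n [L hL]] := fmS0; exists n, L => B /sub; exact: hL.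
Qed.

End FinitelyBased.

Lemma generic_overvariety (F : finFieldType) (G : finGroupType) (A : gradedAlg
  F G) :
    finite_set [set: A] ->
  exists S : set (freeAlg F G), [/\ finite_set S, variety_of S A,
    locally_finite (variety_of S) & finitely_many_critical (variety_of S)].
Proof.
move=> /finite_fcard[n An].
have n0 : (0 < n)%N.
  by have [s sn sA] := An; apply: leq_trans sn; case: s sA => // /(_ 0).
have [S [finS SA wS]] := long_word_identities n0 An.
pose S0 := dset n `|` S; have dS0 : dset n `<=` S0 by move=> f; left.
have wS0 (d : nat -> G) : exists2 f, S0 f & ford n.+2
    (f - mulw [seq fvar F (d i, i) | i <- iota 0 n] (fvar F (d n, n))).
  by have [f Sf fo] := wS d; exists f => //; right.
have lf : locally_finite (variety_of S0).
  by move=> B SB; apply: dset_locally_finite n0 _ (subset_trans dS0 SB).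
exists S0; split=> //.
- by rewrite finite_setU; split=> //; apply: finite_dset.
- by move=> f [/(dset_identity An)|/SA].
apply: (finitely_many_critical_variety lf _ A) => B SB cB.
have [k Bk] := finite_fcard cB.1.
have [J [hJ J0 maxJ]] := max_nilpotent_ideal wS0 SB Bk.
have spQ := radical_quot_semiprime (hJ := hJ) J0 maxJ.
have [Ts [uTs mTs sTs]] := semiprime_decomposition (quot_fcard Bk hJ) spQ.
exact: (critical_generators n0 dS0 SB Bk J0 maxJ cB uTs mTs sTs).
Qed.

Theorem theorem4p19 (G : finGroupType) (F : finFieldType) (A : gradedAlg F G)
    (finA : finite_set [set: A]) :
  Cross (var A) /\
  exists S : set (freeAlg F G),
    finite_set S /\ T_G A = smallest (@TG_ideal F G) S.
Proof.
have [S0 [finS0 S0A lf fm]] := generic_overvariety finA.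
have crossA := subvariety_Cross finS0 lf fm S0A; split=> //.
have [_ [S [finS varS]] _] := crossA.
by exists S; split=> //; apply: T_G_basis.
Qed.
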